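(* Let $E$ be a complex Banach space, let $\mathcal U\subset\mathbb C$ be an open set conformally equivalent to the open unit disk $\mathcal D$, and let $\mathcal X$ be an interpolation field on $\mathcal U$ (with values in $E$). Then for all $\xi,\eta\in\mathcal U$, $$d_K(X_\xi,X_\eta)\le 2h(\xi,\eta).$$
   Context: An interpolation field on $\mathcal U$ is a vector space $\mathcal X$ of analytic functions $f:\mathcal U\to E$ equipped with a norm $\|\cdot\|_{\mathcal X}$ making it a Banach space, such that (1) for every conformal equivalence $\varphi:\mathcal U\to\mathcal D$, $f\in\mathcal X$ if and only if $\varphi f\in\mathcal X$, and then $\|f\|_{\mathcal X}=\|\varphi f\|_{\mathcal X}$; (2) for each $w\in\mathcal U$ the evaluation $f\mapsto f(w)$ is bounded from $\mathcal X$ to $E$. For $w\in\mathcal U$, $X_w$ is the space of $x\in E$ such that $x=f(w)$ for some $f\in\mathcal X$, with norm $\|x\|_w=\inf\{\|f\|_{\mathcal X}: f(w)=x\}$. The pseudo-hyperbolic distance is $h(\xi,\eta)=|\varphi(\eta)|$, where $\varphi:\mathcal U\to\mathcal D$ is a conformal equivalence with $\varphi(\xi)=0$. The Kadets distance $d_K(X,Y)$ between Banach spaces is the infimum, over all Banach spaces $Z$ and linear isometric embeddings $U:X\to Z$, $V:Y\to Z$, of the Hausdorff distance between the images $UB_X$ and $VB_Y$ of the closed unit balls. *)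

(* Defs.v *)
(* The complex numbers are mathcomp-real-closed's
   [R[i]] (= complex R) over an arbitrary realType R, packaged as a
   numClosedFieldType so that MathComp-Analysis' normed structure applies. *)
From HB Require Import structures.
From mathcomp Require Import all_boot all_order all_algebra.
From mathcomp Require Import all_classical all_reals all_analysis.
From mathcomp.real_closed Require Import complex.
Import Order.TTheory GRing.Theory Num.Theory.
Import numFieldNormedType.Exports.

Set Implicit Arguments.
Unset Strict Implicit.
Unset Printing Implicit Defensive.

Local Open Scope ring_scope.
Local Open Scope classical_set_scope.

Definition Cx (R : realType) : numClosedFieldType := (R[i] : numClosedFieldType).

Section Defs.
Variable R : realType.
Local Notation C := (Cx R).

(* Real-valued norm: in a normed space over C, `|x| is a (real) element of C;
   we take its real part to view it in R. *)
Definition nrm (V : normedModType C) (x : V) : R := complex.Re (`|x| : R[i]).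

Definition disk : set C := [set z : C | nrm z < 1].

Definition holo_on (V : normedModType C) (U : set C) (f : C -> V) : Prop :=
  forall z, U z -> derivable f z 1.

Definition conformal_equiv (U : set C) (phi : C -> C) : Prop :=
  holo_on U phi /\ set_bij U disk phi.

Definition represents (E : normedModType C) (X : normedModType C)
  (U : set C) (F : X -> C -> E) (x : X) (f : C -> E) : Prop :=
  forall z, U z -> F x z = f z.

(* An interpolation field on U with values in E: a Banach space X (over C)
   identified, via the linear injective map F, with a vector space of
   analytic functions U -> E, such that (1) conformal invariance holds and
   (2) point evaluations are bounded. *)
Definition is_interpolation_field (E : completeNormedModType C)
  (X : completeNormedModType C) (U : set C) (F : X -> C -> E) : Prop :=
  [/\
      (forall (a : C) (x y : X) z, U z -> F (a *: x + y) z = a *: F x z + F y z),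
      (forall x y : X, (forall z, U z -> F x z = F y z) -> x = y),
      (forall x : X, holo_on U (F x)),
      (forall phi, conformal_equiv U phi ->
        forall f : C -> E, holo_on U f ->
          ((exists x, represents U F x f) <->
           (exists y, represents U F y (fun z => phi z *: f z))) /\
          (forall x y, represents U F x f ->
             represents U F y (fun z => phi z *: f z) -> nrm x = nrm y)) &
      (forall w, U w -> exists M : R, forall x : X, nrm (F x w) <= M * nrm x)].

Definition Xw (E X : normedModType C) (F : X -> C -> E) (w : C) : set E :=
  [set v | exists x : X, F x w = v].

Definition Xw_norm (E X : normedModType C) (F : X -> C -> E) (w : C) (v : E) : R :=
  inf [set nrm x | x in [set x : X | F x w = v]].

(* A normed space given as a linear subspace S of E with a norm n. *)
Definition ball1 (E : normedModType C) (S : set E) (n : E -> R) : set E :=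
  [set u | S u /\ n u <= 1].

Definition lin_isometry (E Z : normedModType C) (S : set E) (n : E -> R)
  (T : E -> Z) : Prop :=
  (forall (a : C) u v, S u -> S v -> T (a *: u + v) = a *: T u + T v) /\
  (forall u, S u -> nrm (T u) = n u).

Definition dist_set (Z : normedModType C) (z : Z) (B : set Z) : R :=
  inf [set nrm (z - b) | b in B].

Definition hausdorff (Z : normedModType C) (A B : set Z) : R :=
  Num.max (sup [set dist_set a B | a in A]) (sup [set dist_set b A | b in B]).

Definition kadets (E : normedModType C) (S1 : set E) (n1 : E -> R)
  (S2 : set E) (n2 : E -> R) : R :=
  inf [set r | exists (Z : completeNormedModType C) (T V : E -> Z),
         [/\ lin_isometry S1 n1 T, lin_isometry S2 n2 V &
             r = hausdorff (T @` ball1 S1 n1) (V @` ball1 S2 n2)]].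

End Defs.

(* Main.v *)
Require Import Defs.
From HB Require Import structures.
From mathcomp Require Import all_boot all_order all_algebra.
From mathcomp Require Import all_classical all_reals all_analysis.
From mathcomp.real_closed Require Import complex.
From mathcomp Require Import ring lra.
Import Order.TTheory GRing.Theory Num.Theory.
Import numFieldNormedType.Exports.
Local Open Scope ring_scope.
Local Open Scope classical_set_scope.
Set Implicit Arguments.
Unset Strict Implicit.
Unset Printing Implicit Defensive.

(** Let [a = phi eta] and let [psi] be [phi] followed by the Moebius map sending
    [a] to [0], so that [psi eta = 0] and [|psi xi| = |a|].  If [F x] and [F y]
    agree at [eta], then [F x - F y = psi * g] with [g] in the field and of norm
    [|x - y|]; evaluating at [xi] yields
      [|F x xi|_xi <= |F x eta|_eta + 2 |a| |x|],
    and symmetrically with [xi] and [eta] exchanged.  For [delta > 2 |a|] the two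
    spaces therefore embed isometrically in the sum [X_xi + X_eta] normed by
      [|(u, v)| = inf { |y| + |z| + delta |x| :
         u = F y xi + F x xi, v = F z eta - F x eta }],
    where [F x xi] and [F x eta] lie at distance at most [delta |x|].

    The division by [psi] requires that complex differentiable functions with
    values in a Banach space have complex differentiable divided differences, and
    that injective ones have nonvanishing derivatives.  Both come from Cauchy's
    formula on a triangle, whose sides are integrated by dyadic Riemann sums. *)

(** The factor 2 comes from a competitor [y] for the norm at [eta]: the correction has norm at most
    [|x| + |y|], and the infimum over [y] is at most [|x|]. The embeddings are isometric because a
    representation of [(u, 0)] forces [F z eta = F x eta], so the estimate bounds the [X_xi] norm of
    [F x xi] by [|z| + delta |x|]. The strict inequality [delta > 2 |a|] keeps [delta] positive when
    [a = 0]; the weight then controls [x], which separation and completeness of the sum rely on.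
    Representing its elements by triples from the field gives completeness without a completion. On
    the analytic side only pointwise complex differentiability is given. One bisection principle
    takes the place of compactness, and the integral of 1/(z - e) is only bounded below, which is
    enough to divide by it in place of 2 pi i. *)

Section Norm.
Variable R : realType.
Local Notation C := (Cx R).
Local Notation toC := (real_complex R : R -> Cx R).
Implicit Types V : normedModType C.

(** * Real-valued norms and completeness of the complex numbers *)

Lemma normE V (x : V) : `|x| = toC (nrm x).
Proof. by rewrite /nrm; apply/esym/RRe_real; exact: normr_real. Qed.

Lemma nrm_ge0 V (x : V) : 0 <= nrm x.
Proof. by rewrite -lecR -normE normr_ge0. Qed.

Lemma nrmD V (x y : V) : nrm (x + y) <= nrm x + nrm y.
Proof. by rewrite -lecR rmorphD /= -!normE ler_normD. Qed.

Lemma nrmN V (x : V) : nrm (- x) = nrm x.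
Proof. by rewrite /nrm normrN. Qed.

Lemma nrm_distC V (x y : V) : nrm (x - y) = nrm (y - x).
Proof. by rewrite -nrmN opprB. Qed.

Lemma nrmB V (x y : V) : nrm (x - y) <= nrm x + nrm y.
Proof. by rewrite -(nrmN y) nrmD. Qed.

Lemma nrm_tri V (x y z : V) : nrm (x - z) <= nrm (x - y) + nrm (y - z).
Proof. by rewrite (le_trans _ (nrmD _ _)) // addrA subrK. Qed.

Lemma nrmZ V (a : C) (x : V) : nrm (a *: x) = nrm a * nrm x.
Proof. by apply: (@complexI R); rewrite rmorphM /= -!normE normrZ. Qed.

Lemma nrmM (a b : C) : nrm (a * b) = nrm a * nrm b.
Proof. exact: (@nrmZ C). Qed.

Lemma nrm0 V : nrm (0 : V) = 0.
Proof. by rewrite /nrm normr0. Qed.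

Lemma nrm_eq0 V (x : V) : (nrm x == 0) = (x == 0).
Proof.
apply/eqP/eqP => [x0|->]; last exact: nrm0.
by apply/eqP; rewrite -normr_eq0 normE x0.
Qed.

Lemma nrm_gt0 V (x : V) : (0 < nrm x) = (x != 0).
Proof. by rewrite lt_def nrm_ge0 andbT nrm_eq0. Qed.

Lemma nrmV (a : C) : nrm a^-1 = (nrm a)^-1.
Proof. by apply: (@complexI R); rewrite fmorphV /= -!normE normfV. Qed.

Lemma nrm_toC (t : R) : nrm (toC t) = `|t|.
Proof. by rewrite /nrm normc_def /= expr0n /= addr0 sqrtr_sqr. Qed.

Lemma nrm_sq (z : C) : nrm z ^+ 2 = complex.Re z ^+ 2 + complex.Im z ^+ 2.
Proof. by apply: (@complexI R); rewrite rmorphXn /= -normE add_Re2_Im2. Qed.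

Lemma Re_le_nrm (z : C) : `|complex.Re z| <= nrm z.
Proof.
rewrite -(@ler_pXn2r R 2) ?nnegrE ?normr_ge0 ?nrm_ge0 //.
by rewrite nrm_sq -normrX ger0_norm ?sqr_ge0 // lerDl sqr_ge0.
Qed.

Lemma Im_le_nrm (z : C) : `|complex.Im z| <= nrm z.
Proof.
rewrite -(@ler_pXn2r R 2) ?nnegrE ?normr_ge0 ?nrm_ge0 //.
by rewrite nrm_sq -normrX ger0_norm ?sqr_ge0 // lerDr sqr_ge0.
Qed.

Lemma nrm_le_ReIm (z : C) : nrm z <= `|complex.Re z| + `|complex.Im z|.
Proof.
rewrite -(@ler_pXn2r R 2) ?nnegrE ?addr_ge0 ?normr_ge0 ?nrm_ge0 //.
rewrite nrm_sq sqrrD !real_normK ?num_real //.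
by rewrite lerD2r lerDl mulrn_wge0 // mulr_ge0.
Qed.

Lemma gt0_toC (e : C) : 0 < e -> exists2 d : R, 0 < d & e = toC d.
Proof.
move=> e0; have er : e \is Num.real by rewrite realE ltW.
exists (complex.Re e); last by rewrite (RRe_real er).
by rewrite -ltcR (RRe_real er).
Qed.

Lemma nbhs_nrmP V (z : V) (P : set V) :
  nbhs z P <-> exists2 d : R, 0 < d & forall w, nrm (w - z) < d -> P w.
Proof.
split=> [/nbhs_normP[e /= /gt0_toC[d d0 ->] H]|[d d0 H]].
  by exists d => // w wz; apply: H; rewrite /ball_ /= normE ltcR nrm_distC.
apply/nbhs_normP; exists (toC d) => /=; first by rewrite ltcR.
by move=> w; rewrite /ball_ /= normE ltcR nrm_distC; exact: H.
Qed.

Lemma cvg_nrmP (T : Type) (F : set_system T) {FF : Filter F} V (f : T -> V) (l : V) :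
  f @ F --> l <-> forall e : R, 0 < e -> \forall t \near F, nrm (f t - l) < e.
Proof.
split=> [/cvgrPdist_lt H e e0|H].
  have /H : 0 < toC e by rewrite ltcR.
  by apply: filterS => t; rewrite normE ltcR nrm_distC.
apply/cvgrPdist_lt => e /gt0_toC[d d0 ->].
by apply: filterS (H d d0) => t; rewrite normE ltcR nrm_distC.
Qed.

Lemma continuous_nrmP V (f : C -> V) z : {for z, continuous f} <->
  forall e : R, 0 < e -> exists2 d : R, 0 < d &
    forall w, nrm (w - z) < d -> nrm (f w - f z) < e.
Proof.
split=> [H e e0|H].
  by move: H => /cvg_nrmP /(_ e e0) /nbhs_nrmP.
by apply/(cvg_nrmP (F := nbhs z)) => e e0; apply/nbhs_nrmP; exact: H.
Qed.

Lemma cauchy_nrmP V (F : set_system V) : ProperFilter F ->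
  (cauchy F <-> forall e : R, 0 < e -> exists x, F [set y | nrm (y - x) < e]).
Proof.
move=> FF; split=> [cF e e0|H].
  have H : cauchy_ex F by apply/cauchyP.
  have /H[x Fx] : 0 < toC e by rewrite ltcR.
  exists x; apply: filterS Fx => y.
  by rewrite -ball_normE /ball_ /= normE ltcR nrm_distC.
apply/cauchyP => e /gt0_toC[d d0 ->].
have [x Fx] := H d d0; exists x; apply: filterS Fx => y.
by rewrite -ball_normE /ball_ /= normE ltcR nrm_distC.
Qed.

(** Real and imaginary parts are 1-Lipschitz, hence preserve Cauchy filters. Completeness lets [C]
    itself be a target of integrals, as the Cauchy kernel requires. *)
Lemma C_complete (F : set_system C) : ProperFilter F -> cauchy F -> cvg F.
Proof.
move=> FF /(cauchy_nrmP FF) cF; apply/cvg_ex.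
have key (p : C -> R) : (forall z w, `|p z - p w| <= nrm (z - w)) ->
    cvg (p @ F).
  move=> pl; apply/cauchy_cvgP/cauchyP => e e0.
  have [x Fx] := cF e e0; exists (p x); apply: (@filterS _ F _ _ _ _ Fx) => y yx.
  rewrite -ball_normE /ball_ /=.
  by apply: le_lt_trans (pl _ _) _; rewrite nrm_distC.
have /cvg_ex[a Ha] : cvg ((@complex.Re R) @ F).
  by apply: key => z w; rewrite -raddfB; exact: Re_le_nrm.
have /cvg_ex[b Hb] : cvg ((@complex.Im R) @ F).
  by apply: key => z w; rewrite -raddfB; exact: Im_le_nrm.
exists (Complex a b); apply/(cvg_nrmP (F := F) id) => e e0.
have e2 : 0 < e / 2 by rewrite divr_gt0.
move/cvgrPdist_lt/(_ _ e2): Ha => Ha; move/cvgrPdist_lt/(_ _ e2): Hb => Hb.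
near=> z; apply: le_lt_trans (nrm_le_ReIm _) _.
rewrite [e]splitr ltrD //.
  by near: z; apply: filterS Ha => -[x y] /=; rewrite distrC.
by near: z; apply: filterS Hb => -[x y] /=; rewrite distrC.
Unshelve. all: by end_near. Qed.

HB.instance Definition _ := Uniform_isComplete.Build C C_complete.

End Norm.

(** * Caratheodory derivatives, geometric convergence and bisection *)

Section Halving.
Variable R : realType.
Local Notation C := (Cx R).
Implicit Types V : normedModType C.

(** Caratheodory's criterion, with [q z] the derivative. It reduces product rules, removable
    singularities and first-order errors to algebra and continuity of [q]. *)
Lemma derivable_caratheodory V (f : C -> V) (z : C) : derivable f z 1 <->
  exists2 q : C -> V, {for z, continuous q} &
    forall w, f w - f z = (w - z) *: q w.
Proof.
split=> [/cvg_ex[l /cvg_nrmP fl]|[q /continuous_nrmP qc fq]].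
  exists (fun w => if w == z then l else (w - z)^-1 *: (f w - f z)).
    apply/continuous_nrmP => e e0; have [d d0 H] := (nbhs_nrmP _ _).1 (fl e e0).
    exists d => // w wz; rewrite eqxx; have [_|wNz] := eqVneq w z.
      by rewrite subrr nrm0.
    have := H (w - z); rewrite subr0 => /(_ wz); rewrite subr_eq0 => /(_ wNz) /=.
    by rewrite [X in f (X + _)]mulr1 subrK.
  move=> w; have [->|wNz] := eqVneq w z; first by rewrite !subrr scale0r.
  by rewrite scalerA divff ?subr_eq0 // scale1r.
apply/cvg_ex; exists (q z); apply/(cvg_nrmP (F := (0 : C)^')) => e e0.
have [d d0 H] := qc e e0; apply/nbhs_nrmP; exists d => // h; rewrite subr0 => hd h0 /=.
rewrite [X in f (X + _)]mulr1 fq addrK scalerA mulVf // scale1r.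
by apply: H; rewrite addrK.
Qed.

Lemma derivable_continuous V (f : C -> V) (z : C) :
  derivable f z 1 -> {for z, continuous f}.
Proof. by move=> /derivable1_diffP; exact: differentiable_continuous. Qed.

Section Continuity.
Variable V : normedModType C.
Implicit Types (f g : C -> V) (k : C -> C) (v : V) (z : C).

Lemma continuous_at_cst v z : {for z, continuous (fun _ : C => v)}.
Proof. exact: (cvg_cst v (F := nbhs z)). Qed.

Lemma continuous_at_id z : {for z, continuous (fun w : C => w)}.
Proof. by move=> A. Qed.

Lemma continuous_at_D f g z : {for z, continuous f} -> {for z, continuous g} ->
  {for z, continuous (fun w => f w + g w)}.
Proof. by move=> fz gz; exact: (cvgD (F := nbhs z) fz gz). Qed.

Lemma continuous_at_N f z : {for z, continuous f} -> {for z, continuous (fun w => - f w)}.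
Proof. by move=> fz; exact: (cvgN (F := nbhs z) fz). Qed.

Lemma continuous_at_B f g z : {for z, continuous f} -> {for z, continuous g} ->
  {for z, continuous (fun w => f w - g w)}.
Proof. by move=> fz gz; apply: continuous_at_D fz _; exact: continuous_at_N. Qed.

Lemma continuous_at_Z k f z : {for z, continuous k} -> {for z, continuous f} ->
  {for z, continuous (fun w => k w *: f w)}.
Proof. by move=> kz fz; exact: (cvgZ (F := nbhs z) kz fz). Qed.

Lemma continuous_at_V k z : k z != 0 -> {for z, continuous k} ->
  {for z, continuous (fun w => (k w)^-1)}.
Proof. by move=> k0 kz; exact: (cvgV (F := nbhs z) k0 kz). Qed.

End Continuity.

Lemma half_pow_small (c e : R) : 0 < e -> exists n, c * 2^-1 ^+ n < e.
Proof.
move=> e0; have [c0|c0] := leP c 0.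
  by exists 0; rewrite expr0 mulr1 (le_lt_trans c0).
exists (Num.bound (c / e)).
have := @archi_boundP R (c / e); rewrite divr_ge0 ?ltW // => /(_ isT).
set n := Num.bound _ => cn; rewrite exprVn ltr_pdivrMr ?exprn_gt0 //.
rewrite mulrC -ltr_pdivrMr //; apply: lt_le_trans cn _.
by rewrite -natrX ler_nat ltnW // ltn_expl.
Qed.

Lemma lim_nrm_le V (u : nat -> V) (l x : V) (c : R) : u @ \oo --> l ->
  (\forall n \near \oo, nrm (u n - x) <= c) -> nrm (l - x) <= c.
Proof.
move=> /cvg_nrmP ul uc; apply/ler_addgt0Pr => e e0.
have [n [un cn]] : exists n, nrm (u n - l) < e /\ nrm (u n - x) <= c.
  by near \oo => n; exists n; split; near: n => //; exact: ul.
rewrite (le_trans (nrm_tri _ (u n) _)) // addrC lerD // nrm_distC ltW //.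
Unshelve. all: by end_near. Qed.

Lemma geometric_cvg (V : completeNormedModType C) (u : nat -> V) (c : R) :
  (forall n, nrm (u n.+1 - u n) <= c * 2^-1 ^+ n) ->
  exists2 l, u @ \oo --> l & forall n, nrm (u n - l) <= 2 * c * 2^-1 ^+ n.
Proof.
move=> uc; have c0 : 0 <= c.
  by have := uc 0%N; rewrite expr0 mulr1; apply: le_trans; exact: nrm_ge0.
have h0 n : 0 <= (2^-1 : R) ^+ n by rewrite exprn_ge0.
have key n k : nrm (u (n + k)%N - u n) <= 2 * c * 2^-1 ^+ n.
  (* The exact geometric remainder is what passes through the induction on [k]. *)
  suff H : nrm (u (n + k)%N - u n) <= 2 * c * (2^-1 ^+ n - 2^-1 ^+ (n + k)).
    by apply: (le_trans H); rewrite ler_wpM2l ?mulr_ge0 // gerBl.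
  elim: k => [|k IH]; first by rewrite addn0 !subrr nrm0 mulr0.
  rewrite addnS (le_trans (nrm_tri _ (u (n + k)%N) _)) //.
  rewrite (le_trans (lerD (uc _) IH)) // exprS.
  by set t := _ ^+ (n + k); set s := _ ^+ n; lra.
have cu : cauchy (u @ \oo).
  apply/cauchy_nrmP => e e0; have [N HN] := half_pow_small (2 * c) e0.
  exists (u N); suff : \forall n \near \oo, nrm (u n - u N) < e by [].
  near=> n; apply: le_lt_trans HN.
  have -> : n = (N + (n - N))%N by rewrite subnKC //; near: n; exact: nbhs_infty_ge.
  exact: key.
have /cvg_ex[l ul] : cvg (u @ \oo) by exact: cauchy_cvg.
exists l => // n; rewrite nrm_distC; apply: (lim_nrm_le ul).
near=> m.
have -> : m = (n + (m - n))%N by rewrite subnKC //; near: m; exact: nbhs_infty_ge.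
exact: key.
Unshelve. all: by end_near. Qed.

(* If [P] passes from the halves of a figure to the figure, and holds for all
   small figures near each point, it holds everywhere: otherwise some nested
   sequence of halves would shrink to a point contradicting the latter. *)
Lemma local_to_global (T : Type) (pos : T -> C) (size : T -> R)
    (D P : T -> Prop) (K : set C) : closed K ->
  (forall t, D t -> K (pos t)) ->
  (forall t, D t -> (forall t', D t' -> size t' = size t / 2 ->
      nrm (pos t' - pos t) <= size t -> P t') -> P t) ->
  (forall z, K z -> exists2 d : R, 0 < d & forall t, D t -> size t < d ->
      nrm (pos t - z) <= 2 * size t -> P t) ->
  forall t, D t -> P t.
Proof.
move=> cK DK Pstep Ploc t0 Dt0; apply: contrapT => nPt0.
have step (s : {t | D t /\ ~ P t}) : exists s' : {t | D t /\ ~ P t},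
    size (sval s') = size (sval s) / 2 /\
    nrm (pos (sval s') - pos (sval s)) <= size (sval s).
  case: s => t [Dt nPt] /=; apply: contrapT => H; apply: nPt.
  apply: Pstep => // t' Dt' st' pt'; apply: contrapT => nPt'.
  by apply: H; exists (exist _ t' (conj Dt' nPt')).
have [f fP] := choice step.
pose t n := sval (iter n f (exist _ t0 (conj Dt0 nPt0))).
have tS n : size (t n) = size t0 * 2^-1 ^+ n.
  elim: n => [|n IH]; first by rewrite expr0 mulr1.
  by rewrite /t iterS (fP _).1 -/(t n) IH exprSr mulrA.
have tD n : D (t n) /\ ~ P (t n) by rewrite /t; case: (iter _ _ _).
(* Steps are bounded by sizes that halve, so the limit is within twice the current size: hence the
   factor 2 in the local hypothesis. *)
have [|z tz zt] := @geometric_cvg C (fun n => pos (t n)) (size t0).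
  by move=> n; rewrite -tS; exact: (fP _).2.
have Kz : K z.
  apply: (closed_cvg _ cK _ _ tz) => //; near=> n; exact: DK (tD n).1.
have [d d0 H] := Ploc z Kz.
have [n nd] := half_pow_small (size t0) d0.
case: (tD n) => Dn; apply; apply: H => //; first by rewrite tS.
by rewrite tS mulrA; exact: zt.
Unshelve. all: by end_near. Qed.

End Halving.

(** * Dyadic Riemann sums and integrals over segments *)

Section Integral.
Variable R : realType.
Local Notation C := (Cx R).
Implicit Types (a b c z w : C) (K : set C) (n : nat).

Definition mid a b : C := (a + b) / 2.

Lemma midB a b : mid a b - a = (b - a) / 2.
Proof. by rewrite /mid; field. Qed.

Lemma Bmid a b : b - mid a b = (b - a) / 2.
Proof. by rewrite /mid; field. Qed.

Lemma midC a b : mid a b = mid b a.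
Proof. by rewrite /mid addrC. Qed.

Lemma nrm_half a : nrm (a / 2) = nrm a / 2.
Proof.
rewrite nrmM nrmV; congr (_ / _).
by rewrite /nrm ger0_norm //= rmorph_nat.
Qed.

(** Bisection creates only midpoints, so this much convexity serves for Riemann sums and subdivided
    triangles. *)
Definition midconvex K := forall a b, K a -> K b -> K (mid a b).

Lemma midconvexI K L : midconvex K -> midconvex L -> midconvex (K `&` L).
Proof. by move=> mK mL a b [Ka La] [Kb Lb]; split; [exact: mK|exact: mL]. Qed.

Lemma midconvex_ball z (r : R) : midconvex [set w | nrm (w - z) <= r].
Proof.
move=> a b /= az bz.
have -> : mid a b - z = (a - z) / 2 + (b - z) / 2 by rewrite /mid; field.
by rewrite (le_trans (nrmD _ _)) // !nrm_half; lra.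
Qed.

Lemma closed_nrm_ball z (r : R) : closed [set w : C | nrm (w - z) <= r].
Proof.
move=> w wz; apply/ler_addgt0Pr => e e0.
have : nbhs w [set v : C | nrm (v - w) < e] by apply/nbhs_nrmP; exists e.
move/wz => [v [/= vz vw]].
by rewrite (le_trans (nrm_tri _ v _)) // addrC lerD // nrm_distC ltW.
Qed.

Section Sums.
Variable V : normedModType C.
Implicit Types (f g : C -> V) (v : V).

(* The left Riemann sum of [f dz] over [[a, b]] with [2 ^ n] equal steps. *)
Fixpoint rsum f n a b : V :=
  if n is m.+1 then rsum f m a (mid a b) + rsum f m (mid a b) b
  else (b - a) *: f a.

Lemma rsumD f g n a b :
  rsum (fun z => f z + g z) n a b = rsum f n a b + rsum g n a b.
Proof.
elim: n a b => [|n IH] a b /=; first by rewrite scalerDr.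
by rewrite !IH addrACA.
Qed.

Lemma rsumZ (k : C) f n a b :
  rsum (fun z => k *: f z) n a b = k *: rsum f n a b.
Proof.
elim: n a b => [|n IH] a b /=; first by rewrite scalerA mulrC -scalerA.
by rewrite !IH scalerDr.
Qed.

(** In degree one the error of the left sum is explicit. The case [v = 0] handles constants; the
    limit integrates affine functions. *)
Lemma rsum_affine (u v : V) n a b : rsum (fun z => u + z *: v) n a b =
  (b - a) *: u + ((b ^+ 2 - a ^+ 2) / 2 - (b - a) ^+ 2 / 2 * 2^-1 ^+ n) *: v.
Proof.
elim: n a b => [|n IH] a b /=.
  by rewrite expr0 scalerDr scalerA; congr (_ + _ *: _); field.
rewrite !IH addrACA -!scalerDl [2^-1 ^+ n.+1]exprS; set t := 2^-1 ^+ n.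
by congr (_ *: _ + _ *: _); rewrite /mid; field.
Qed.

(** Reversal turns left sums into right sums; with equal steps their difference telescopes to one
    step times a difference of end values. *)
Lemma rsum_rev f n a b :
  rsum f n b a = - rsum f n a b + ((2^-1 ^+ n) * (b - a)) *: (f a - f b).
Proof.
elim: n a b => [|n IH] a b /=.
  by rewrite expr0 mul1r scalerBr addrA addNr add0r -scaleNr opprB.
rewrite (midC b a) (IH a (mid a b)) (IH (mid a b) b) addrC addrACA -opprD.
congr (_ + _); rewrite midB Bmid -scalerDr addrA subrK exprS.
by congr (_ *: _); set t := _ ^+ n; field.
Qed.

Lemma rsum_le K f (M : R) n a b : midconvex K -> K a -> K b ->
  (forall z, K z -> nrm (f z) <= M) -> nrm (rsum f n a b) <= nrm (b - a) * M.
Proof.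
move=> mK; elim: n a b => [|n IH] a b Ka Kb fM /=.
  by rewrite nrmZ ler_wpM2l ?nrm_ge0 // fM.
have Km := mK _ _ Ka Kb.
rewrite (le_trans (nrmD _ _)) // (le_trans (lerD (IH _ _ Ka Km fM) (IH _ _ Km Kb fM))) //.
by rewrite midB Bmid nrm_half; lra.
Qed.

Lemma rsum_eq K f g n a b : midconvex K -> K a -> K b ->
  (forall z, K z -> f z = g z) -> rsum f n a b = rsum g n a b.
Proof.
move=> mK; elim: n a b => [|n IH] a b Ka Kb fg /=; first by rewrite fg.
by have Km := mK _ _ Ka Kb; rewrite !IH.
Qed.

End Sums.

Lemma rsum_scale (V : normedModType C) (k : C -> C) (v : V) n a b :
  rsum (fun z => k z *: v) n a b = (rsum k n a b : C) *: v.
Proof.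
elim: n a b => [|n IH] a b /=; first by rewrite scalerA.
by rewrite !IH scalerDl.
Qed.

Definition continuous_on (V : normedModType C) K (f : C -> V) :=
  forall z, K z -> {for z, continuous f}.

Variable V : completeNormedModType C.
Implicit Types (f g : C -> V) (v : V).

Definition segint f a b : V := lim (rsum f n a b @[n --> \oo]).

(** Being Cauchy up to an error proportional to the length adds up over two halves. By bisection it
    is enough to treat short segments near a point, where [f] is almost constant. *)
Lemma rsum_cvg K f a b : closed K -> midconvex K -> continuous_on K f ->
  K a -> K b -> rsum f n a b @[n --> \oo] --> segint f a b.
Proof.
move=> cK mK cf Ka Kb; suff : cvg (rsum f n a b @[n --> \oo]) by [].
apply: cauchy_cvg; apply/cauchy_nrmP => e e0.
pose D (t : C * C) := K t.1 /\ K t.2.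
pose e' := e / (nrm (b - a) + 1).
have nab : 0 < nrm (b - a) + 1 by rewrite ltr_wpDl // nrm_ge0.
have e'0 : 0 < e' by rewrite divr_gt0.
pose P (t : C * C) := exists N, forall m n, (N <= m)%N -> (N <= n)%N ->
  nrm (rsum f m t.1 t.2 - rsum f n t.1 t.2) <= nrm (t.2 - t.1) * e'.
have : P (a, b).
  apply: (@local_to_global R _ (fun t => t.1) (fun t => nrm (t.2 - t.1)) D P K) => //.
  - by move=> t [].
  - move=> [x y] [/= Kx Ky] H; have Km := mK _ _ Kx Ky.
    have [||//|N1 H1] := H (x, mid x y); rewrite /D /= ?midB ?nrm_half ?subrr ?nrm0 //.
      exact: nrm_ge0.
    have [||//|N2 H2] := H (mid x y, y); rewrite /D /= ?midB ?Bmid ?nrm_half //.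
      by rewrite ler_pdivrMr // ler_peMr ?nrm_ge0 // ler1n.
    exists (maxn N1 N2).+1 => -[//|m] [//|n]; rewrite !ltnS !geq_max.
    move=> /andP[m1 m2] /andP[n1 n2] /=.
    rewrite opprD addrACA (le_trans (nrmD _ _)) //.
    rewrite (le_trans (lerD (H1 _ _ m1 n1) (H2 _ _ m2 n2))) //=.
    by rewrite midB Bmid nrm_half; lra.
  move=> z Kz; have e'2 : 0 < e' / 2 by rewrite divr_gt0.
  have [d d0 H] := (continuous_nrmP _ _).1 (cf z Kz) _ e'2.
  (* Since [x] is within [2 * nrm (y - x)] of [z], both ends are within [3 * nrm (y - x)], which is
     less than [d]. *)
  exists (d / 4); first by rewrite divr_gt0.
  move=> [x y] [/= Kx Ky] xyd xz; exists 0%N => m n _ _ /=.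
  pose L := [set w : C | nrm (w - z) <= 3 * nrm (y - x)].
  have Lf w : L w -> nrm (f w - f z) <= e' / 2.
    by rewrite /L /= => wL; apply/ltW/H; apply: le_lt_trans wL _; lra.
  have Lx : L x by rewrite /L /= (le_trans xz) // ler_wpM2r ?nrm_ge0 // ler_nat.
  have Ly : L y by rewrite /L /=; have := nrm_tri y x z; lra.
  have key k : nrm (rsum f k x y - (y - x) *: f z) <= nrm (y - x) * (e' / 2).
    rewrite (_ : _ - _ = rsum (fun w => f w - f z) k x y); last first.
      rewrite (rsumD f (fun=> - f z)); congr (_ + _).
      have := rsum_affine (- f z) 0 k x y; rewrite scaler0 addr0 scalerN => <-.
      apply: (@rsum_eq _ setT) => // w _.
      by rewrite scaler0 addr0.
    by apply: (@rsum_le _ L) => //; exact: midconvex_ball.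
  rewrite (le_trans (nrm_tri _ ((y - x) *: f z) _)) //.
  have := key m; have := key n; rewrite (nrm_distC (rsum _ n _ _)); lra.
move=> [N HN]; exists (rsum f N a b).
suff : \forall n \near \oo, nrm (rsum f n a b - rsum f N a b) < e by [].
near=> n; apply: le_lt_trans (HN n N _ _) _ => //=.
  by near: n; exact: nbhs_infty_ge.
by rewrite /e' mulrA ltr_pdivrMr // mulrC ltr_pM2l // ltrDl.
Unshelve. all: by end_near. Qed.

End Integral.

(** * Properties of the integral and Goursat's theorem for triangles *)

Section Goursat.
Variable R : realType.
Local Notation C := (Cx R).
Implicit Types (a b c z w : C) (K : set C) (n : nat).

Lemma half_pow_cvg0 : (2^-1 : C) ^+ n @[n --> \oo] --> (0 : C).
Proof.
apply/(cvg_nrmP (F := \oo)) => e e0; have [N HN] := half_pow_small 1 e0.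
have n1 : nrm (1 : C) = 1 by rewrite /nrm normr1.
have nh : nrm (2^-1 : C) = 2^-1 by rewrite -[X in nrm X]mul1r nrm_half n1 mul1r.
have nrmh n : nrm ((2^-1 : C) ^+ n) = 2^-1 ^+ n.
  by elim: n => [|n IH]; rewrite ?expr0 // !exprS nrmM IH nh.
near=> n; rewrite subr0 nrmh; apply: le_lt_trans HN.
rewrite mul1r ler_wiXn2l ?invr_ge0 ?invf_le1 ?ler1n //.
by near: n; exact: nbhs_infty_ge.
Unshelve. all: by end_near. Qed.

Variable V : completeNormedModType C.
Implicit Types (f g : C -> V) (v : V).

Section OnK.
Variables (K : set C) (cK : closed K) (mK : midconvex K).

Lemma segint_lim f a b l : rsum f n a b @[n --> \oo] --> l -> segint f a b = l.
Proof. by move=> fl; apply/cvg_lim. Qed.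

Lemma segint_mid f a b : continuous_on K f -> K a -> K b ->
  segint f a b = segint f a (mid a b) + segint f (mid a b) b.
Proof.
move=> cf Ka Kb; have Km := mK Ka Kb; apply: segint_lim; rewrite -cvg_shiftS /=.
by apply: cvgD; apply: (rsum_cvg cK mK).
Qed.

Lemma segint_rev f a b : continuous_on K f -> K a -> K b -> segint f b a = - segint f a b.
Proof.
move=> cf Ka Kb; apply: segint_lim; under eq_cvg do rewrite rsum_rev.
rewrite -[- segint f a b]addr0 -(scale0r (f a - f b)) -(mul0r (b - a)).
apply: cvgD; first by apply: cvgN; apply: (rsum_cvg cK mK).
apply: cvgZr_tmp; apply: cvgMr_tmp.
exact: half_pow_cvg0.
Qed.

Lemma segintD f g a b : continuous_on K f -> continuous_on K g -> K a -> K b ->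
  segint (fun z => f z + g z) a b = segint f a b + segint g a b.
Proof.
move=> cf cg Ka Kb; apply: segint_lim; under eq_cvg do rewrite rsumD.
by apply: cvgD; apply: (rsum_cvg cK mK).
Qed.

Lemma segintZ k f a b : continuous_on K f -> K a -> K b ->
  segint (fun z => k *: f z) a b = k *: segint f a b.
Proof.
move=> cf Ka Kb; apply: segint_lim; under eq_cvg do rewrite rsumZ.
by apply: cvgZl_tmp; apply: (rsum_cvg cK mK).
Qed.

(** [K] provides convergence, while the bound is asked on [L], which may be as thin as the segment
    itself. *)
Lemma segint_le f a b (M : R) (L : set C) : continuous_on K f -> K a -> K b ->
  midconvex L -> L a -> L b -> (forall z, L z -> nrm (f z) <= M) ->
  nrm (segint f a b) <= nrm (b - a) * M.
Proof.
move=> cf Ka Kb mL La Lb fM.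
rewrite -[segint f a b]subr0; apply: (lim_nrm_le (rsum_cvg cK mK cf Ka Kb)).
by near=> n; rewrite subr0; apply: (rsum_le _ mL).
Unshelve. all: by end_near. Qed.

Lemma eq_segint f g a b : (forall z, K z -> f z = g z) -> K a -> K b ->
  segint f a b = segint g a b.
Proof.
move=> fg Ka Kb; rewrite /segint.
suff -> : (fun n => rsum f n a b) = (fun n => rsum g n a b) by [].
by apply/funext => n; apply: (rsum_eq _ mK).
Qed.

End OnK.

Lemma segint_affine (u v : V) a b : segint (fun z => u + z *: v) a b =
  (b - a) *: u + ((b ^+ 2 - a ^+ 2) / 2) *: v.
Proof.
rewrite -[(b ^+ 2 - a ^+ 2) / 2]subr0 -(mulr0 ((b - a) ^+ 2 / 2)).
apply: segint_lim; under eq_cvg do rewrite rsum_affine.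
apply: cvgD; first exact: cvg_cst.
apply: cvgZr_tmp; apply: cvgB; [exact: cvg_cst|apply: cvgMl_tmp].
exact: half_pow_cvg0.
Qed.

Definition tri f a b c : V := segint f a b + segint f b c + segint f c a.

Section TriOnK.
Variables (K : set C) (cK : closed K) (mK : midconvex K).

Lemma tri_le f a b c (M : R) : continuous_on K f -> K a -> K b -> K c ->
  (forall z, K z -> nrm (f z) <= M) ->
  nrm (tri f a b c) <= (nrm (b - a) + nrm (c - b) + nrm (a - c)) * M.
Proof.
move=> cf Ka Kb Kc fM; rewrite !mulrDl.
have le x y : K x -> K y -> nrm (segint f x y) <= nrm (y - x) * M.
  by move=> Kx Ky; apply: (segint_le cK mK cf Kx Ky mK).
rewrite (le_trans (nrmD _ _)) // lerD ?le //.
by rewrite (le_trans (nrmD _ _)) // lerD ?le.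
Qed.

Lemma tri_split f a b c : continuous_on K f -> K a -> K b -> K c ->
  tri f a b c = tri f a (mid a b) (mid c a) + tri f (mid a b) b (mid b c) +
    tri f (mid c a) (mid b c) c + tri f (mid b c) (mid c a) (mid a b).
Proof.
move=> cf Ka Kb Kc.
have [Kab Kbc Kca] : [/\ K (mid a b), K (mid b c) & K (mid c a)].
  by split; exact: mK.
rewrite /tri (segint_mid cK mK cf Ka Kb) (segint_mid cK mK cf Kb Kc) (segint_mid cK mK cf Kc Ka).
rewrite (segint_rev cK mK cf Kab Kca) (segint_rev cK mK cf Kbc Kab) (segint_rev cK mK cf Kca Kbc).
rewrite [RHS](AC (3*3*3*3) ((1*4)*(5*8)*(9*3)*(2*11)*(6*12)*(7*10))) /=.
by rewrite !subrr !addr0.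
Qed.

End TriOnK.

(** The bound [e * size ^+ 2] survives subdivision: four triangles of half the size contribute a
    quarter each. On a small triangle [f] is affine up to [(w - z) *: (q w - q z)], and affine
    functions have integral zero. *)
Lemma goursat K f a b c : closed K -> midconvex K ->
  (forall z, K z -> derivable f z 1) ->
  K a -> K b -> K c -> tri f a b c = 0.
Proof.
move=> cK mK df Ka Kb Kc.
have cf : continuous_on K f by move=> z /df; exact: derivable_continuous.
pose D (t : C * C * C) := [/\ K t.1.1, K t.1.2 & K t.2].
(* Measured from the first vertex: in the vertex order of [tri_split] both difference vectors are
   exactly halved, up to sign for the medial triangle. *)
pose size (t : C * C * C) := nrm (t.1.2 - t.1.1) + nrm (t.2 - t.1.1).
suff key (e : R) : 0 < e -> nrm (tri f a b c) <= e * size (a, b, c) ^+ 2.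
  apply/eqP; rewrite -nrm_eq0 eq_le nrm_ge0 andbT; apply/ler_addgt0Pr => e e0.
  rewrite add0r; set s := size (a, b, c) ^+ 2 in key.
  have s0 : 0 <= s by rewrite sqr_ge0.
  have := key (e / (s + 1)); rewrite divr_gt0 ?ltr_wpDl // => /(_ isT) H.
  apply: (le_trans H); rewrite mulrAC ler_pdivrMr ?ltr_wpDl //.
  by apply: ler_wpM2l; [exact: ltW|lra].
move=> e0.
pose P (t : C * C * C) := nrm (tri f t.1.1 t.1.2 t.2) <= e * size t ^+ 2.
suff : P (a, b, c) by [].
apply: (@local_to_global R _ (fun t => t.1.1) size D P K) => //.
- by move=> t [].
- move=> [[x y] z] [/= Kx Ky Kz] H.
  have [Kxy Kyz Kzx] : [/\ K (mid x y), K (mid y z) & K (mid z x)].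
    by split; exact: mK.
  rewrite /P /= (tri_split cK mK cf Kx Ky Kz).
  have n0 := @nrm_ge0 R C.
  have sE (t : C * C * C) : (t.1.2 - t.1.1 = (y - x) / 2 /\ t.2 - t.1.1 = (z - x) / 2)
      \/ (t.1.2 - t.1.1 = - ((y - x) / 2) /\ t.2 - t.1.1 = - ((z - x) / 2)) ->
      size t = size (x, y, z) / 2.
    by case=> -[E1 E2]; rewrite /size E1 E2 ?nrmN !nrm_half /=; lra.
  have H1 : P (x, mid x y, mid z x).
    apply: H; rewrite /D //=; last by rewrite subrr nrm0 addr_ge0.
    by apply: sE; left; rewrite /= /mid; split; field.
  have H2 : P (mid x y, y, mid y z).
    apply: H; rewrite /D //=; last first.
      by rewrite midB nrm_half /size /=; have := n0 (y - x); have := n0 (z - x); lra.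
    by apply: sE; left; rewrite /= /mid; split; field.
  have H3 : P (mid z x, mid y z, z).
    apply: H; rewrite /D //=; last first.
      by rewrite midC midB nrm_half /size /=; have := n0 (y - x); have := n0 (z - x); lra.
    by apply: sE; left; rewrite /= /mid; split; field.
  have H4 : P (mid y z, mid z x, mid x y).
    apply: H; rewrite /D //=; last first.
      have -> : mid y z - x = (y - x) / 2 + (z - x) / 2 by rewrite /mid; field.
      rewrite (le_trans (nrmD _ _)) // !nrm_half /size /=.
      by have := n0 (y - x); have := n0 (z - x); lra.
    by apply: sE; right; rewrite /= /mid; split; field.
  have hs t : P t -> (t.1.2 - t.1.1 = (y - x) / 2 /\ t.2 - t.1.1 = (z - x) / 2)
      \/ (t.1.2 - t.1.1 = - ((y - x) / 2) /\ t.2 - t.1.1 = - ((z - x) / 2)) ->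
      nrm (tri f t.1.1 t.1.2 t.2) <= e * size (x, y, z) ^+ 2 / 4.
    by move=> Pt /sE st; move: Pt; rewrite /P st expr_div_n -natrX mulrA.
  have {}H1 := hs _ H1; have {}H2 := hs _ H2; have {}H3 := hs _ H3; have {}H4 := hs _ H4.
  move: H1 H2 H3 H4 => /= H1 H2 H3 H4.
  have {}H1 := H1 ltac:(by left; rewrite /mid; split; field).
  have {}H2 := H2 ltac:(by left; rewrite /mid; split; field).
  have {}H3 := H3 ltac:(by left; rewrite /mid; split; field).
  have {}H4 := H4 ltac:(by right; rewrite /mid; split; field).
  have tri4 (v1 v2 v3 v4 : V) :
      nrm (v1 + v2 + v3 + v4) <= nrm v1 + nrm v2 + nrm v3 + nrm v4.
    by do 3![rewrite (le_trans (nrmD _ _)) // lerD2r].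
  by rewrite (le_trans (tri4 _ _ _ _)) //; lra.
move=> z Kz.
have /derivable_caratheodory[q /continuous_nrmP qc fq] := df z Kz.
(* The perimeter is at most [2 * s] and distances to [z] at most [3 * s]; times [e / 6] this is
   [e * s ^+ 2]. *)
have e6 : 0 < e / 6 by rewrite divr_gt0.
have [d d0 H] := qc _ e6.
exists (d / 4); first by rewrite divr_gt0.
move=> [[x y] t] [/= Kx Ky Kt] sd xz; rewrite /P /=.
set s := size (x, y, t) in sd xz *.
have n0 := @nrm_ge0 R C.
have s0 : 0 <= s by rewrite /s /size addr_ge0.
pose L := K `&` [set w : C | nrm (w - z) <= 3 * s].
have cL : closed L by apply: closedI => //; exact: closed_nrm_ball.
have mL : midconvex L by apply: midconvexI => //; exact: midconvex_ball.
have Lx : L x by split=> //=; lra.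
have Ly : L y.
  split=> //=; have := nrm_tri y x z; have := n0 (t - x); move: xz; rewrite /s /size /=; lra.
have Lt : L t.
  split=> //=; have := nrm_tri t x z; have := n0 (y - x); move: xz; rewrite /s /size /=; lra.
pose g w : V := (f z - z *: q z) + w *: q z.
have cg : continuous_on L g.
  move=> w _; apply: continuous_at_D; first exact: continuous_at_cst.
  by apply: continuous_at_Z; [exact: continuous_at_id|exact: continuous_at_cst].
have cfg : continuous_on L (fun w => f w - g w).
  by move=> w Lw; apply: continuous_at_B; [apply: cf; case: Lw|exact: cg].
have E1 : tri f x y t = tri (fun w => (f w - g w) + g w) x y t.
  by rewrite /tri; congr (segint _ _ _ + segint _ _ _ + segint _ _ _); apply/funext => w; rewrite subrK.
have E2 : tri (fun w => (f w - g w) + g w) x y t = tri (fun w => f w - g w) x y t.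
  set u := f z - z *: q z.
  have gE (z1 z2 : C) : segint (fun w => g w) z1 z2 = (z2 - z1) *: u + ((z2 ^+ 2 - z1 ^+ 2) / 2) *: q z.
    exact: segint_affine.
  rewrite /tri !(segintD cL mL cfg cg) // !gE.
  rewrite [LHS](AC (2*2*2) ((1*3*5)*(2*4*6))) /= -[RHS]addr0; congr (_ + _).
  rewrite [LHS](AC (2*2*2) ((1*3*5)*(2*4*6))) /= -!(scalerDl u) -!(scalerDl (q z)).
  rewrite -[RHS](addr0 (0 : V)) -{1}(scale0r u) -(scale0r (q z)).
  by congr (_ *: _ + _ *: _); field.
rewrite E1 E2.
have err w : L w -> nrm (f w - g w) <= 3 * s * (e / 6).
  move=> [_ /= wz].
  have -> : f w - g w = (w - z) *: (q w - q z).
    rewrite scalerBr -fq /g scalerBl !opprD !opprK -!addrA.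
    by congr (_ + (_ + _)); rewrite addrC.
  by rewrite nrmZ ler_pM ?n0 ?nrm_ge0 //; apply/ltW/H; lra.
apply: le_trans (tri_le cL mL cfg Lx Ly Lt err) _.
have : nrm (y - x) + nrm (t - y) + nrm (x - t) <= 2 * s.
  rewrite /s /size /= (nrm_distC x t); have := nrm_tri t x y; rewrite (nrm_distC x y); lra.
move=> per; rewrite (_ : e * s ^+ 2 = 2 * s * (3 * s * (e / 6))); last by field.
by apply: ler_wpM2r => //; rewrite !mulr_ge0 // ltW.
Qed.

End Goursat.

(** * Half-planes, triangles with a singular vertex, and the imaginary part of sums of 1/(z - e) *)

Section Contour.
Variable R : realType.
Local Notation C := (Cx R).
Local Notation toC := (real_complex R : R -> Cx R).
Implicit Types (a b c z w : C).

Lemma ReD z w : complex.Re (z + w) = complex.Re z + complex.Re w.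
Proof. exact: raddfD. Qed.

Lemma ReB z w : complex.Re (z - w) = complex.Re z - complex.Re w.
Proof. exact: raddfB. Qed.

Lemma ImD z w : complex.Im (z + w) = complex.Im z + complex.Im w.
Proof. exact: raddfD. Qed.

Lemma ImB z w : complex.Im (z - w) = complex.Im z - complex.Im w.
Proof. exact: raddfB. Qed.

Lemma mid_double a b : mid a b + mid a b = a + b.
Proof. by rewrite /mid; field. Qed.

Lemma Re_mid a b : complex.Re (mid a b) = (complex.Re a + complex.Re b) / 2.
Proof. by have := congr1 (@complex.Re R) (mid_double a b); rewrite !ReD; lra. Qed.

Lemma Im_mid a b : complex.Im (mid a b) = (complex.Im a + complex.Im b) / 2.
Proof. by have := congr1 (@complex.Im R) (mid_double a b); rewrite !ImD; lra. Qed.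

(** Half-planes defined by such forms are closed and midconvex, and serve to keep triangles away
    from a singular point. *)
Definition linform (p q : R) z : R := p * complex.Re z + q * complex.Im z.

Lemma linformB p q z w : linform p q (z - w) = linform p q z - linform p q w.
Proof. by rewrite /linform ReB ImB; ring. Qed.

Lemma linform_mid p q a b :
  linform p q (mid a b) = (linform p q a + linform p q b) / 2.
Proof. by rewrite /linform Re_mid Im_mid; field. Qed.

Lemma linform_le p q z : `|linform p q z| <= (`|p| + `|q|) * nrm z.
Proof.
rewrite /linform (le_trans (ler_normD _ _)) // !normrM mulrDl lerD //.
  by rewrite ler_wpM2l // Re_le_nrm.
by rewrite ler_wpM2l // Im_le_nrm.
Qed.

Lemma midconvex_half p q (s : R) : midconvex [set z : C | s <= linform p q z].
Proof. by move=> a b /= sa sb; rewrite linform_mid; lra. Qed.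

Lemma closed_half p q (s : R) : closed [set z : C | s <= linform p q z].
Proof.
move=> z Hz; apply/ler_addgt0Pr => e e0.
set m := `|p| + `|q| + 1; have m0 : 0 < m by rewrite ltr_wpDl // addr_ge0.
have : nbhs z [set v : C | nrm (v - z) < e / m].
  by apply/nbhs_nrmP; exists (e / m) => //; rewrite divr_gt0.
move/Hz => [v [/= sv vz]].
have := linform_le p q (v - z); rewrite linformB ler_norml => /andP[_ H].
have : (`|p| + `|q|) * nrm (v - z) <= e.
  apply: (@le_trans _ _ (m * (e / m))); last by rewrite mulrCA divff ?mulr1 ?gt_eqF.
  by rewrite ler_pM ?addr_ge0 ?nrm_ge0 // ?(ltW vz) // /m lerDl.
lra.
Qed.

Section Vertex.
Variables (V : completeNormedModType C) (K : set C).
Hypotheses (cK : closed K) (mK : midconvex K).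

(** Three of the four subtriangles lie in a half-plane missing [w], where [goursat] applies. The
    remaining corner shrinks to [w] under halving; there [f] is bounded and the perimeter tends to
    0. *)
Lemma goursat_vertex (f : C -> V) (p q s : R) w b c : continuous_on K f ->
  (forall z, K z -> z != w -> derivable f z 1) -> K w -> K b -> K c -> 0 < s ->
  s <= linform p q (b - w) -> s <= linform p q (c - w) -> tri f w b c = 0.
Proof.
move=> cf df Kw Kb Kc s0 sb sc.
apply/eqP; rewrite -nrm_eq0 eq_le nrm_ge0 andbT; apply/ler_addgt0Pr => e e0.
rewrite add0r.
pose D (t : C * C) := [/\ K t.1, K t.2 &
  exists2 r : R, 0 < r & r <= linform p q (t.1 - w) /\ r <= linform p q (t.2 - w)].
pose size (t : C * C) := nrm (t.1 - w) + nrm (t.2 - w).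
pose P (t : C * C) := nrm (tri f w t.1 t.2) <= e.
have n0 := @nrm_ge0 R C.
suff : P (b, c) by [].
(* All triangles keep the vertex [w], so the closed set of positions is the point [w], written as a
   ball of radius 0. *)
apply: (@local_to_global R _ (fun=> w) size D P [set z : C | nrm (z - w) <= 0]).
- exact: closed_nrm_ball.
- by move=> t _ /=; rewrite subrr nrm0.
- move=> [x y] [/= Kx Ky [r r0 [rx ry]]] H; rewrite /P /= (tri_split cK mK) //.
  have [Kwx Kwy Kxy] : [/\ K (mid w x), K (mid w y) & K (mid x y)].
    by split; exact: mK.
  have E z : linform p q (mid w z - w) = linform p q (z - w) / 2.
    by rewrite !linformB linform_mid; field.
  have Exy : linform p q (mid x y - w) = (linform p q (x - w) + linform p q (y - w)) / 2.
    by rewrite !linformB linform_mid; field.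
  have : P (mid w x, mid w y).
    apply: H; last by rewrite subrr nrm0 addr_ge0.
      by split=> //=; exists (r / 2); rewrite ?divr_gt0 //= !E; split; lra.
    by rewrite /size /= !midB !nrm_half; lra.
  pose L := K `&` [set z | r / 2 + linform p q w <= linform p q z].
  have cL : closed L by apply: closedI => //; exact: closed_half.
  have mL : midconvex L by apply: midconvexI => //; exact: midconvex_half.
  have LP z : K z -> r / 2 <= linform p q (z - w) -> L z.
    by move=> Kz; rewrite linformB => ?; split=> //=; lra.
  have dL z : L z -> derivable f z 1.
    move=> [Kz /= zL]; apply: df => //; apply: contraPneq zL => ->.
    by apply/negP; rewrite -ltNge; lra.
  rewrite (midC y w) /P /=.
  rewrite [tri f (mid w x) _ _](goursat cL mL) //; first last.
  - by apply: LP => //; rewrite Exy; lra.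
  - by apply: LP => //; lra.
  - by apply: LP => //; rewrite E; lra.
  rewrite [tri f (mid w y) _ _](goursat cL mL) //; first last.
  - by apply: LP => //; lra.
  - by apply: LP => //; rewrite Exy; lra.
  - by apply: LP => //; rewrite E; lra.
  rewrite [tri f (mid x y) _ _](goursat cL mL) //; first last.
  - by apply: LP => //; rewrite E; lra.
  - by apply: LP => //; rewrite E; lra.
  - by apply: LP => //; rewrite Exy; lra.
  by rewrite !addr0.
- move=> z _; have [d d0 H] := (continuous_nrmP _ _).1 (cf w Kw) _ ltr01.
  pose M := nrm (f w) + 1; have M0 : 0 < M by rewrite ltr_wpDl // nrm_ge0.
  exists (Num.min d (e / (2 * M))); first by rewrite lt_min d0 divr_gt0 // mulr_gt0.
  move=> [x y] [/= Kx Ky _]; rewrite lt_min => /andP[sd se] _; rewrite /P /=.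
  pose L := K `&` [set v | nrm (v - w) <= size (x, y)].
  have cL : closed L by apply: closedI => //; exact: closed_nrm_ball.
  have mL : midconvex L by apply: midconvexI => //; exact: midconvex_ball.
  have fL v : L v -> nrm (f v) <= M.
    move=> [_ /= /le_lt_trans /(_ sd) /H].
    have := nrm_tri (f v) (f w) 0; rewrite !subr0 /M; lra.
  have cfL : continuous_on L f by move=> v [Kv _]; exact: cf.
  apply: le_trans (tri_le cL mL cfL _ _ _ fL) _.
  - by split=> //=; rewrite subrr nrm0 addr_ge0.
  - by split=> //=; rewrite /size /=; have := n0 (y - w); lra.
  - by split=> //=; rewrite /size /=; have := n0 (x - w); lra.
  rewrite ltr_pdivlMr ?mulr_gt0 // in se.
  apply: (@le_trans _ _ (2 * size (x, y) * M)); last lra.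
  rewrite ler_pM2r // /size /= (nrm_distC w y).
  by have := nrm_tri y w x; rewrite (nrm_distC w x); lra.
by split=> //=; exists s.
Qed.

Lemma tri_cone (f : C -> V) w a b c : continuous_on K f ->
  K w -> K a -> K b -> K c ->
  tri f a b c = tri f w a b + tri f w b c + tri f w c a.
Proof.
move=> cf Kw Ka Kb Kc; rewrite /tri.
rewrite (segint_rev cK mK cf Kw Ka) (segint_rev cK mK cf Kw Kb).
rewrite (segint_rev cK mK cf Kw Kc).
rewrite [RHS](AC (3*3*3) ((2*5*8)*(1*9)*(4*3)*(7*6))) /=.
by rewrite !subrr !addr0.
Qed.

End Vertex.

Lemma mul_conj z : z * (z^* )%C = toC (nrm z ^+ 2).
Proof. by rewrite -sqr_normc rmorphXn /= -normE. Qed.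

Lemma Im_mul_toC z (t : R) : complex.Im (z * toC t) = complex.Im z * t.
Proof. by case: z => x y /=; rewrite mulr0 add0r. Qed.

Lemma Im_div z w : complex.Im (z / w) = complex.Im (z * (w^* )%C) / nrm w ^+ 2.
Proof.
have [->|w0] := eqVneq w 0.
  by rewrite invr0 mulr0 nrm0 expr0n /= invr0 mulr0.
apply: (mulIf (x := nrm w ^+ 2)).
  by rewrite expf_eq0 /= nrm_eq0.
rewrite divfK ?expf_eq0 ?nrm_eq0 // -Im_mul_toC -mul_conj.
by rewrite mulrA divfK.
Qed.

(** Twice the signed area of the triangle [0], [w], [z]; over [nrm w ^+ 2] it is the imaginary part
    of [z / w]. *)
Definition cross z w : R := complex.Im (z * (w^* )%C).

Lemma crossE z w :
  cross z w = complex.Im z * complex.Re w - complex.Re z * complex.Im w.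
Proof. by rewrite /cross; case: z w => [a b] [c d] /=; ring. Qed.

(** One term has imaginary part [cross (b - a) (a - e) / nrm (a - e) ^+ 2]. Each half of a segment
    carries half of its cross product, so the bound adds up under subdivision. *)
Lemma rsum_inv_Im e (r : R) n a b : nrm (a - e) <= r -> nrm (b - e) <= r -> 0 < r ->
  0 <= cross (b - a) (a - e) ->
  cross (b - a) (a - e) / r ^+ 2 <=
    complex.Im (rsum (fun z => (z - e)^-1 : C) n a b : C).
Proof.
move=> + + r0; elim: n a b => [|n IH] a b ar br ab0 /=.
  rewrite Im_div -/(cross _ _); have [ae|ae] := eqVneq (a - e) 0.
    by rewrite ae crossE /= !mulr0 subrr !mul0r.
  rewrite ler_wpM2l // lef_pV2 ?posrE ?exprn_gt0 ?nrm_gt0 //.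
  by rewrite ler_pXn2r ?nnegrE ?nrm_ge0 // ltW.
have mr : nrm (mid a b - e) <= r by exact: midconvex_ball.
have E1 : cross (mid a b - a) (a - e) = cross (b - a) (a - e) / 2.
  by rewrite !crossE !ReB !ImB Re_mid Im_mid; field.
have E2 : cross (b - mid a b) (mid a b - e) = cross (b - a) (a - e) / 2.
  by rewrite !crossE !ReB !ImB Re_mid Im_mid; field.
rewrite ImD.
have := IH _ _ ar mr; rewrite E1 => /(_ _)/wrap[]; first lra.
have := IH _ _ mr br; rewrite E2 => /(_ _)/wrap[]; first lra.
rewrite !(mulrAC _ 2^-1); set t := _ / r ^+ 2; lra.
Qed.

End Contour.

(** * Rules of derivation and the triangular contour *)

Section Cauchy.
Variable R : realType.
Local Notation C := (Cx R).
Implicit Types (a b c z w : C).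

Section Rules.
Variable V : normedModType C.
Implicit Types (f q : C -> V) (k : C -> C).

Lemma derivable_of_near f q z (d : R) : 0 < d -> {for z, continuous q} ->
  (forall w, nrm (w - z) < d -> f w - f z = (w - z) *: q w) -> derivable f z 1.
Proof.
move=> d0 qc fq; pose g w := f z + (w - z) *: q w.
have : derivable g z 1.
  apply/derivable_caratheodory; exists q => // w.
  by rewrite /g subrr scale0r addr0 addrC addKr.
apply: near_eq_derivable; apply/nbhs_nrmP; exists d => // w /fq.
by rewrite /g => <-; rewrite addrC subrK.
Qed.

Lemma derivable_scale k f z : derivable k z 1 -> derivable f z 1 ->
  derivable (fun w => k w *: f w) z 1.
Proof.
move=> dk df; have cf := derivable_continuous df.
move/derivable_caratheodory: dk => [qk ck kq].
move/derivable_caratheodory: df => [qf cqf fq].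
apply/derivable_caratheodory; exists (fun w => qk w *: f w + k z *: qf w).
  apply: continuous_at_D; first by apply: continuous_at_Z; [exact: ck|exact: cf].
  by apply: continuous_at_Z; [exact: continuous_at_cst|exact: cqf].
move=> w; rewrite scalerDr !scalerA (mulrC (w - z) (k z)) -(scalerA (k z)) -fq.
have -> : (w - z) * qk w = k w - k z by rewrite kq.
by rewrite scalerBl scalerBr addrA subrK.
Qed.

Lemma derivable_divided f w z : z != w -> derivable f z 1 ->
  derivable (fun v => (v - w)^-1 *: (f v - f w)) z 1.
Proof.
move=> zw df; apply: derivable_scale.
  apply: derivableV; first by rewrite subr_eq0.
  by apply: derivableB; [exact: derivable_id|exact: derivable_cst].
by apply: derivableB; [exact: df|exact: derivable_cst].
Qed.

End Rules.

Variables (e : C) (r : R).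
Hypothesis r0 : 0 < r.

(** The contour runs counterclockwise around [e]; coordinates relative to [e] are at most [r] in
    modulus, so the triangle fits in the ball of radius [2 * r]. *)
Definition v0 : C := e + Complex r 0.
Definition v1 : C := e + Complex (- r) r.
Definition v2 : C := e + Complex (- r) (- r).

Definition cball : set C := [set z | nrm (z - e) <= 2 * r].

(* Contains the side of the contour on which [linform p q (z - e)] is the
   constant [r] (or [2 * r]), and stays away from the centre [e]. *)
Definition side (p q : R) : set C :=
  [set z | r + linform p q e <= linform p q z] `&` cball.

(** The coefficients are outward normals of the three edges. Each edge is thickened to a closed
    midconvex piece on which the Cauchy kernel is continuous. *)
Definition sides : set C := side 1 2 `|` side (-2) 0 `|` side 1 (-2).

Lemma closed_side p q : closed (side p q).
Proof. by apply: closedI; [exact: closed_half|exact: closed_nrm_ball]. Qed.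

Lemma midconvex_side p q : midconvex (side p q).
Proof. by apply: midconvexI; [exact: midconvex_half|exact: midconvex_ball]. Qed.

Lemma vertexE (x y : R) : e + Complex x y - e = Complex x y :> C.
Proof. by rewrite addrC addKr. Qed.

Lemma vertexB (A B : C) : e + A - (e + B) = A - B.
Proof. by ring. Qed.

Lemma vertex_side (p q x y : R) : `|x| <= r -> `|y| <= r ->
  r <= p * x + q * y -> side p q (e + Complex x y).
Proof.
move=> xr yr xy; split; rewrite /cball /=.
  have -> : linform p q (e + Complex x y) = linform p q e + (p * x + q * y).
    by rewrite /linform ReD ImD /=; ring.
  by rewrite addrC lerD2l.
by rewrite vertexE (le_trans (nrm_le_ReIm _)) //=; lra.
Qed.

Lemma side_v0 : side 1 2 v0 /\ side 1 (-2) v0.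
Proof. by split; apply: vertex_side; rewrite ?normr0 ?(gtr0_norm r0) ?(ltW r0) //; lra. Qed.

Lemma side_v1 : side 1 2 v1 /\ side (-2) 0 v1.
Proof. split; apply: vertex_side; rewrite ?normrN ?(gtr0_norm r0) ?(ltW r0) //; move: r0 => ?; lra. Qed.

Lemma side_v2 : side (-2) 0 v2 /\ side 1 (-2) v2.
Proof. by split; apply: vertex_side; rewrite ?normrN ?(gtr0_norm r0) ?(ltW r0) //; move: r0 => ?; lra. Qed.

Lemma side_cball p q z : side p q z -> cball z.
Proof. by case. Qed.

Lemma sidesP z : sides z -> exists p q : R, side p q z /\ `|p| + `|q| <= 3.
Proof.
by move=> [[|]|] H; [exists 1, 2|exists (-2), 0|exists 1, (-2)]; split=> //;
  rewrite ?normrN ?normr0 ?normr1 !ger0_norm //; lra.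
Qed.

(** All three forms satisfy the bound 3, and [3 * r / 8 <= r / 2]. The margin [r / 2] left in the
    form then amounts to a distance of at least [r / 6 >= r / 8] to the sides. *)
Lemma linform_near p q w : `|p| + `|q| <= 3 -> nrm (w - e) <= r / 8 ->
  `|linform p q (w - e)| <= r / 2.
Proof.
move=> pq we; rewrite (le_trans (linform_le _ _ _)) //.
have := ler_pM (addr_ge0 (normr_ge0 p) (normr_ge0 q)) (nrm_ge0 (w - e)) pq we.
by have := nrm_ge0 (w - e); lra.
Qed.

Lemma side_apart p q z w : `|p| + `|q| <= 3 -> side p q z -> nrm (w - e) <= r / 8 ->
  r / 2 <= linform p q (z - w).
Proof.
move=> pq [/= zs _] /(linform_near pq); rewrite ler_norml => /andP[_].
by rewrite !linformB; lra.
Qed.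

Lemma sides_far z w : sides z -> nrm (w - e) <= r / 8 -> r / 8 <= nrm (z - w).
Proof.
move=> /sidesP[p [q [zs pq]]] we; have := side_apart pq zs we.
have := linform_le p q (z - w); have := nrm_ge0 (z - w); have := ler_norm (linform p q (z - w)).
have := ler_wpM2r (nrm_ge0 (z - w)) pq; lra.
Qed.

Lemma sides_neq z w : sides z -> nrm (w - e) <= r / 8 -> z - w != 0.
Proof.
move=> zs we; rewrite -nrm_gt0; apply: lt_le_trans (sides_far zs we).
by rewrite divr_gt0.
Qed.

Section Contour.
Variable V : completeNormedModType C.
Implicit Types (f g : C -> V) (k : C -> C) (v : V).

Definition contour f := tri f v0 v1 v2.

Lemma continuous_on_sides f : continuous_on sides f ->
  [/\ continuous_on (side 1 2) f, continuous_on (side (-2) 0) f &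
      continuous_on (side 1 (-2)) f].
Proof. by move=> cf; split=> z zs; apply: cf; rewrite /sides /=; tauto. Qed.


Lemma contourD f g : continuous_on sides f -> continuous_on sides g ->
  contour (fun z => f z + g z) = contour f + contour g.
Proof.
move=> /continuous_on_sides[f0 f1 f2] /continuous_on_sides[g0 g1 g2].
have [[s00 s20] [s01 s11] [s12 s22]] := And3 side_v0 side_v1 side_v2.
rewrite /contour /tri.
rewrite (segintD (@closed_side 1 2) (@midconvex_side 1 2) f0 g0) //.
rewrite (segintD (@closed_side (-2) 0) (@midconvex_side (-2) 0) f1 g1) //.
rewrite (segintD (@closed_side 1 (-2)) (@midconvex_side 1 (-2)) f2 g2) //.
by rewrite [LHS](AC (2*2*2) ((1*3*5)*(2*4*6))).
Qed.

Lemma contourZ (a : C) f : continuous_on sides f ->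
  contour (fun z => a *: f z) = a *: contour f.
Proof.
move=> /continuous_on_sides[f0 f1 f2].
have [[s00 s20] [s01 s11] [s12 s22]] := And3 side_v0 side_v1 side_v2.
rewrite /contour /tri !scalerDr.
rewrite (segintZ (@closed_side 1 2) (@midconvex_side 1 2) _ f0) //.
rewrite (segintZ (@closed_side (-2) 0) (@midconvex_side (-2) 0) _ f1) //.
by rewrite (segintZ (@closed_side 1 (-2)) (@midconvex_side 1 (-2)) _ f2).
Qed.

Lemma contourB f g : continuous_on sides f -> continuous_on sides g ->
  contour (fun z => f z - g z) = contour f - contour g.
Proof.
move=> cf cg; rewrite contourD //; last by move=> z /cg; exact: continuous_at_N.
rewrite -scaleN1r -contourZ //; congr (_ + contour _).
by apply/funext => z; rewrite scaleN1r.
Qed.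

Lemma eq_contour f g : (forall z, sides z -> f z = g z) -> contour f = contour g.
Proof.
move=> fg; have [[s00 s20] [s01 s11] [s12 s22]] := And3 side_v0 side_v1 side_v2.
rewrite /contour /tri; congr (_ + _ + _).
- apply: (eq_segint (@midconvex_side 1 2)) => // z zs.
  by apply: fg; rewrite /sides /=; tauto.
- apply: (eq_segint (@midconvex_side (-2) 0)) => // z zs.
  by apply: fg; rewrite /sides /=; tauto.
- apply: (eq_segint (@midconvex_side 1 (-2))) => // z zs.
  by apply: fg; rewrite /sides /=; tauto.
Qed.

(** Each edge has length at most [3 * r]. The sets [L0], [L1], [L2] allow the bound to be taken on
    thickened sides or on bare edges. *)
Lemma contour_le_on f (M : R) (L0 L1 L2 : set C) : continuous_on sides f ->
  midconvex L0 -> midconvex L1 -> midconvex L2 -> L0 v0 -> L0 v1 -> L1 v1 ->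
  L1 v2 -> L2 v2 -> L2 v0 -> (forall z, (L0 `|` L1 `|` L2) z -> nrm (f z) <= M) ->
  nrm (contour f) <= 9 * r * M.
Proof.
move=> /continuous_on_sides[f0 f1 f2] m0 m1 m2 L00 L01 L11 L12 L22 L20 fM.
have [[s00 s20] [s01 s11] [s12 s22]] := And3 side_v0 side_v1 side_v2.
have M0 : 0 <= M by rewrite (le_trans (nrm_ge0 (f v0))) // fM //=; tauto.
have bnd (x y : R) : `|x| + `|y| <= 3 * r -> forall a b, b - a = Complex x y ->
    nrm (b - a) * M <= 3 * r * M.
  move=> xy a b ->; rewrite ler_wpM2r // (le_trans (nrm_le_ReIm _)) //.
have b0 : nrm (v1 - v0) * M <= 3 * r * M.
  apply: (bnd (- 2 * r) r); last by rewrite /v1 /v0 vertexB; congr Complex => /=; ring.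
  by rewrite normrM normrN !gtr0_norm //; move: r0 => ?; lra.
have b1 : nrm (v2 - v1) * M <= 3 * r * M.
  apply: (bnd 0 (- 2 * r)); last by rewrite /v1 /v2 vertexB; congr Complex => /=; ring.
  by rewrite normrM normrN normr0 !gtr0_norm //; move: r0 => ?; lra.
have b2 : nrm (v0 - v2) * M <= 3 * r * M.
  apply: (bnd (2 * r) r); last by rewrite /v0 /v2 vertexB; congr Complex => /=; ring.
  by rewrite normrM !gtr0_norm //; move: r0 => ?; lra.
rewrite /contour /tri.
have i0 := segint_le (@closed_side 1 2) (@midconvex_side 1 2) f0 s00 s01 m0 L00 L01
  (fun z Lz => fM z (or_introl (or_introl Lz))).
have i1 := segint_le (@closed_side (-2) 0) (@midconvex_side (-2) 0) f1 s11 s12 m1 L11 L12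
  (fun z Lz => fM z (or_introl (or_intror Lz))).
have i2 := segint_le (@closed_side 1 (-2)) (@midconvex_side 1 (-2)) f2 s22 s20 m2 L22 L20
  (fun z Lz => fM z (or_intror Lz)).
have := nrmD (segint f v0 v1 + segint f v1 v2) (segint f v2 v0).
have := nrmD (segint f v0 v1) (segint f v1 v2); lra.
Qed.

Lemma contour_le f (M : R) : continuous_on sides f ->
  (forall z, sides z -> nrm (f z) <= M) -> nrm (contour f) <= 9 * r * M.
Proof.
have [[s00 s20] [s01 s11] [s12 s22]] := And3 side_v0 side_v1 side_v2.
move=> cf fM; apply: (contour_le_on cf (@midconvex_side 1 2) (@midconvex_side (-2) 0)
  (@midconvex_side 1 (-2))) => //.
Qed.

End Contour.

End Cauchy.

(** * Cauchy transforms and Cauchy's formula *)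

Section CauchyFormula.
Variable R : realType.
Local Notation C := (Cx R).
Implicit Types (a b c z w : C).

Section Kernel.
Variables (e : C) (r : R).
Hypothesis r0 : 0 < r.

Lemma contour_scale (V : completeNormedModType C) (k : C -> C) (v : V) :
  continuous_on (sides e r) k ->
  contour e r (fun z => k z *: v) = (contour e r k : C) *: v.
Proof.
move=> /continuous_on_sides[k0 k1 k2].
have [[s00 s20] [s01 s11] [s12 s22]] := And3 (side_v0 e r0) (side_v1 e r0) (side_v2 e r0).
have H K a b : closed K -> midconvex K -> continuous_on K k -> K a -> K b ->
    segint (fun z => k z *: v) a b = (segint k a b : C) *: v.
  move=> cK mK ck Ka Kb; apply: segint_lim; under eq_cvg do rewrite rsum_scale.
  by apply: cvgZr_tmp; apply: (rsum_cvg cK mK).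
rewrite /contour /tri !scalerDl.
rewrite (H _ _ _ (@closed_side _ e r 1 2) (@midconvex_side _ e r 1 2) k0) //.
rewrite (H _ _ _ (@closed_side _ e r (-2) 0) (@midconvex_side _ e r (-2) 0) k1) //.
by rewrite (H _ _ _ (@closed_side _ e r 1 (-2)) (@midconvex_side _ e r 1 (-2)) k2).
Qed.

Lemma kernel_continuous w : nrm (w - e) <= r / 8 ->
  continuous_on (sides e r) (fun z => (z - w)^-1).
Proof.
move=> we z zs; apply: continuous_at_V; first exact: (sides_neq r0 zs we).
by apply: continuous_at_B; [exact: continuous_at_id|exact: continuous_at_cst].
Qed.

Lemma nrm_kernel_le z w : sides e r z -> nrm (w - e) <= r / 8 ->
  nrm (z - w)^-1 <= 8 / r.
Proof.
move=> zs we; rewrite nrmV -invf_div lef_pV2 ?posrE ?divr_gt0 //.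
  exact: (sides_far zs we).
by rewrite nrm_gt0; exact: (sides_neq r0 zs we).
Qed.

Lemma center_near : nrm (e - e) <= r / 8.
Proof. by rewrite subrr nrm0 divr_ge0 // ltW. Qed.

Variable V : completeNormedModType C.
Implicit Types (f g : C -> V).

(** The Cauchy integral without its factor 1/(2 pi i); the transform of the constant 1 will
    normalize it. *)
Definition cauchy_transform g w := contour e r (fun z => (z - w)^-1 *: g z).

Lemma kernelZ_continuous g w : nrm (w - e) <= r / 8 ->
  continuous_on (sides e r) g ->
  continuous_on (sides e r) (fun z => (z - w)^-1 *: g z).
Proof.
by move=> we cg z zs; apply: continuous_at_Z; [exact: (kernel_continuous we)|exact: cg].
Qed.

Lemma cauchy_transform_le g (M : R) w : continuous_on (sides e r) g ->
  (forall z, sides e r z -> nrm (g z) <= M) -> nrm (w - e) <= r / 8 ->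
  nrm (cauchy_transform g w) <= 72 * M.
Proof.
move=> cg gM we.
have -> : 72 * M = 9 * r * (8 / r * M) by field; rewrite gt_eqF.
apply: contour_le => //; first exact: kernelZ_continuous.
move=> z zs; rewrite nrmZ ler_pM ?nrm_ge0 //; last exact: gM.
exact: nrm_kernel_le.
Qed.

(** Integrates [(z - w)^-1 - (z - e)^-1 = (w - e) / ((z - w) * (z - e))]. The divided difference is
    again a transform, so continuity of transforms at [e] yields their differentiability there. *)
Lemma cauchy_transform_diff g w : continuous_on (sides e r) g ->
  nrm (w - e) <= r / 8 ->
  cauchy_transform g w - cauchy_transform g e =
    (w - e) *: cauchy_transform (fun z => (z - e)^-1 *: g z) w.
Proof.
move=> cg we; have ee := center_near.
have cge := kernelZ_continuous ee cg.
rewrite /cauchy_transform -contourB; [|exact: r0|exact: kernelZ_continuous|exact: cge].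
rewrite -contourZ; [|exact: r0|exact: kernelZ_continuous].
apply: (eq_contour r0) => z zs; have zw := sides_neq r0 zs we; have ze := sides_neq r0 zs ee.
by rewrite -scalerBl !scalerA; congr (_ *: _); field; rewrite zw ze.
Qed.

Lemma cauchy_transform_continuous g (M : R) : continuous_on (sides e r) g ->
  (forall z, sides e r z -> nrm (g z) <= M) ->
  {for e, continuous (cauchy_transform g)}.
Proof.
move=> cg gM; apply/continuous_nrmP => d d0.
have ee := center_near; have cge := kernelZ_continuous ee cg.
pose A := 72 * (8 / r * M).
have gM' z : sides e r z -> nrm ((z - e)^-1 *: g z) <= 8 / r * M.
  by move=> zs; rewrite nrmZ ler_pM ?nrm_ge0 //; [exact: nrm_kernel_le|exact: gM].
have A1 : 0 < `|A| + 1 by rewrite ltr_wpDl.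
exists (Num.min (r / 8) (d / (`|A| + 1))).
  by rewrite lt_min !divr_gt0.
move=> w; rewrite lt_min => /andP[/ltW we wd].
rewrite cauchy_transform_diff // nrmZ.
have := cauchy_transform_le cge gM' we; rewrite -/A => H.
rewrite ltr_pdivlMr // in wd; apply: le_lt_trans wd.
by apply: ler_wpM2l; [exact: nrm_ge0|have := ler_norm A; lra].
Qed.

Lemma cauchy_transform_derivable g (M : R) : continuous_on (sides e r) g ->
  (forall z, sides e r z -> nrm (g z) <= M) ->
  derivable (cauchy_transform g) e 1.
Proof.
move=> cg gM; have ee := center_near; have cge := kernelZ_continuous ee cg.
have r8 : 0 < r / 8 by rewrite divr_gt0.
apply: (derivable_of_near r8) => [|w /ltW we]; last exact: cauchy_transform_diff.
apply: (@cauchy_transform_continuous _ (8 / r * M)) => // z zs.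
by rewrite nrmZ ler_pM ?nrm_ge0 //; [exact: nrm_kernel_le|exact: gM].
Qed.

(** The divided difference [q] of [f] at [w] is continuous at [w] and differentiable elsewhere.
    Coning from [w] gives three triangles with vertex [w], so its integral vanishes by
    [goursat_vertex]. *)
Lemma cauchy_formula f w : (forall z, cball e r z -> derivable f z 1) ->
  nrm (w - e) <= r / 8 ->
  cauchy_transform f w = (contour e r (fun z => (z - w)^-1) : C) *: f w.
Proof.
move=> df we.
have cf : continuous_on (sides e r) f.
  move=> z /sidesP[p [q [/side_cball zs _]]]; exact: derivable_continuous (df z zs).
have cw : cball e r w by rewrite /cball /=; move: r0 (nrm_ge0 (w - e)) => ? ?; lra.
have /derivable_caratheodory[q qc fq] := df w cw.
have qE z : z != w -> q z = (z - w)^-1 *: (f z - f w).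
  by move=> zw; rewrite fq scalerA mulVf ?subr_eq0 // scale1r.
have dq z : cball e r z -> z != w -> derivable q z 1.
  move=> zb zw; have : derivable (fun v => (v - w)^-1 *: (f v - f w)) z 1.
    by apply: derivable_divided => //; exact: df.
  apply: near_eq_derivable; apply/nbhs_nrmP; exists (nrm (z - w)).
    by rewrite nrm_gt0 subr_eq0.
  move=> v vz; rewrite qE //; apply: contraTneq vz => ->.
  by rewrite nrm_distC ltxx.
have cq : continuous_on (cball e r) q.
  move=> z zb; have [->|zw] := eqVneq z w; first exact: qc.
  exact: derivable_continuous (dq z zb zw).
have cK := @closed_nrm_ball R e (2 * r); have mK := @midconvex_ball R e (2 * r).
have [[s00 s20] [s01 s11] [s12 s22]] := And3 (side_v0 e r0) (side_v1 e r0) (side_v2 e r0).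
have r2 : 0 < r / 2 by rewrite divr_gt0.
have n12 : `|1 : R| + `|2 : R| <= 3 by rewrite !ger0_norm //; lra.
have n20 : `|-2 : R| + `|0 : R| <= 3 by rewrite normrN normr0 ger0_norm //; lra.
have n12' : `|1 : R| + `|-2 : R| <= 3 by rewrite normrN !ger0_norm //; lra.
have q0 : contour e r q = 0.
  rewrite /contour (tri_cone cK mK cq cw (side_cball s00) (side_cball s01) (side_cball s12)).
  rewrite (goursat_vertex cK mK cq dq cw (side_cball s00) (side_cball s01) r2
    (side_apart n12 s00 we) (side_apart n12 s01 we)).
  rewrite (goursat_vertex cK mK cq dq cw (side_cball s11) (side_cball s12) r2
    (side_apart n20 s11 we) (side_apart n20 s12 we)).
  rewrite (goursat_vertex cK mK cq dq cw (side_cball s22) (side_cball s20) r2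
    (side_apart n12' s22 we) (side_apart n12' s20 we)).
  by rewrite !addr0.
have ck := kernel_continuous we.
apply/eqP; rewrite -subr_eq0 -(contour_scale (f w) ck) /cauchy_transform -contourB //.
- apply/eqP; rewrite -[RHS]q0; apply: (eq_contour r0) => z zs.
  by rewrite -scalerBr qE // -subr_eq0; exact: (sides_neq r0 zs we).
- exact: kernelZ_continuous.
- by move=> z zs; apply: continuous_at_Z; [exact: ck|exact: continuous_at_cst].
Qed.

End Kernel.

(** On each edge the cross product is at least [r ^+ 2] and the distance to [e] at most [2 * r], so
    each edge adds at least 1/4 to the imaginary part. *)
Lemma winding_lower_bound e (r : R) : 0 < r ->
  3 / 4 <= nrm (contour e r (fun z => (z - e)^-1 : C) : C).
Proof.
move=> r0; have ck := kernel_continuous r0 (center_near e r0).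
have [k0 k1 k2] := continuous_on_sides ck.
have [[s00 s20] [s01 s11] [s12 s22]] := And3 (side_v0 e r0) (side_v1 e r0) (side_v2 e r0).
have H K a b : closed K -> midconvex K -> continuous_on K (fun z => (z - e)^-1) ->
    K a -> K b -> cball e r a -> cball e r b -> r ^+ 2 <= cross (b - a) (a - e) ->
    1 / 4 <= complex.Im (segint (fun z => (z - e)^-1 : C) a b : C).
  move=> cK mK ck' Ka Kb ca cb ab; apply/ler_addgt0Pr => d d0.
  have /(cvg_nrmP (F := \oo)) := rsum_cvg cK mK ck' Ka Kb; move=> /(_ d d0) [n _ /(_ n) /= Hn].
  have {}Hn := Hn (leqnn n).
  have r2 : 0 < 2 * r by rewrite mulr_gt0.
  have rr : 0 < r ^+ 2 by rewrite exprn_gt0.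
  have := @rsum_inv_Im R e (2 * r) n a b ca cb r2.
  move=> /(_ _)/wrap[]; first by rewrite (le_trans _ ab) // ltW.
  have : 1 / 4 <= cross (b - a) (a - e) / (2 * r) ^+ 2.
    by rewrite ler_pdivlMr ?exprn_gt0 // exprMn; lra.
  have := Im_le_nrm (rsum (fun z => (z - e)^-1 : C) n a b -
    segint (fun z => (z - e)^-1 : C) a b : C).
  rewrite ImB ler_norml => /andP[? ?]; lra.
apply: le_trans (Im_le_nrm _); apply: le_trans (ler_norm _).
rewrite /contour /tri !ImD.
have cr (x y x' y' : R) : cross (e + Complex x' y' - (e + Complex x y)) (e + Complex x y - e)
    = (y' - y) * x - (x' - x) * y.
  by rewrite vertexB vertexE crossE.
have := H _ _ _ (@closed_side _ e r 1 2) (@midconvex_side _ e r 1 2) k0 s00 s01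
  (side_cball s00) (side_cball s01).
rewrite /v0 /v1 cr => /(_ _)/wrap[]; first by rewrite expr2; nra.
have := H _ _ _ (@closed_side _ e r (-2) 0) (@midconvex_side _ e r (-2) 0) k1 s11 s12
  (side_cball s11) (side_cball s12).
rewrite /v1 /v2 cr => /(_ _)/wrap[]; first by rewrite expr2; nra.
have := H _ _ _ (@closed_side _ e r 1 (-2)) (@midconvex_side _ e r 1 (-2)) k2 s22 s20
  (side_cball s22) (side_cball s20).
rewrite /v0 /v2 cr => /(_ _)/wrap[]; first by rewrite expr2; nra.
lra.
Qed.

End CauchyFormula.

(** * Differentiable divided differences; bisection on segments *)

Section DividedDifference.
Variable R : realType.
Local Notation C := (Cx R).
Local Notation toC := (real_complex R : R -> Cx R).
Implicit Types (a b c z w : C).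

(** Near [e] the transform of [f] is [I w *: f w], with [I] the transform of 1. Expanding both
    transforms at [e] gives the quotient [(I w)^-1 *: (N w - J w *: f e)], where [I], [J] and [N]
    are transforms and hence differentiable at [e]. *)
Lemma divided_difference_derivable (V : completeNormedModType C) (f : C -> V) e (d : R) :
  0 < d -> (forall z, nrm (z - e) < d -> derivable f z 1) ->
  exists2 q : C -> V, derivable q e 1 & forall w, f w - f e = (w - e) *: q w.
Proof.
move=> d0 df; have de : derivable f e 1 by apply: df; rewrite subrr nrm0.
have [d1 d10 fe1] := (continuous_nrmP _ _).1 (derivable_continuous de) _ ltr01.
(* The ball of radius [2 * r] lies strictly inside both radii; [d1] bounds [f] on the sides by
   [nrm (f e) + 1]. *)
pose r := Num.min d d1 / 3.
have r0 : 0 < r by rewrite divr_gt0 // lt_min d0.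
have r3 : 3 * r <= d /\ 3 * r <= d1.
  rewrite /r mulrCA divff ?mulr1 // ?pnatr_eq0 //.
  by split; rewrite ge_min lexx ?orbT.
case: r3 => r3 r31; pose M := nrm (f e) + 1.
have dfb z : cball e r z -> derivable f z 1.
  by rewrite /cball /= => ze; apply: df; lra.
have sb z : sides e r z -> cball e r z by move=> /sidesP[p [q [/side_cball]]].
have cf : continuous_on (sides e r) f by move=> z /sb /dfb; exact: derivable_continuous.
have fM z : sides e r z -> nrm (f z) <= M.
  move=> /sb; rewrite /cball /= => ze.
  have := fe1 z ltac:(lra); have := nrm_tri (f z) (f e) 0; rewrite !subr0 /M; lra.
pose one (z : C) : C := 1.
have c1 : continuous_on (sides e r) one by move=> z _; exact: continuous_at_cst.
have one1 z : sides e r z -> nrm (one z) <= 1 by rewrite /nrm normr1.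
pose I := cauchy_transform e r one.
have IE w : I w = contour e r (fun z => (z - w)^-1 : C).
  rewrite /I /cauchy_transform; apply: (congr1 (@contour R e r C)).
  by apply/funext => z; exact: mulr1.
have I_formula w : nrm (w - e) <= r / 8 -> cauchy_transform e r f w = I w *: f w.
  by move=> we; rewrite IE; exact: cauchy_formula.
have ee := center_near e r0.
have I0 : I e != 0.
  rewrite -nrm_gt0; apply: (@lt_le_trans _ _ (3 / 4)); first by rewrite divr_gt0.
  by rewrite IE; exact: winding_lower_bound.
have bnd (W : completeNormedModType C) (g : C -> W) (N : R) :
    (forall z, sides e r z -> nrm (g z) <= N) ->
    forall z, sides e r z -> nrm ((z - e)^-1 *: g z) <= 8 / r * N.
  by move=> gN z zs; rewrite nrmZ ler_pM ?nrm_ge0 //; [exact: (nrm_kernel_le r0 zs ee)|exact: gN].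
have cf' := kernelZ_continuous r0 ee cf; have fM' := bnd V f M fM.
have c1' := kernelZ_continuous r0 ee c1; have M1' := bnd (C : completeNormedModType C) one 1 one1.
have dI := cauchy_transform_derivable r0 c1 one1.
have dJ := cauchy_transform_derivable r0 c1' M1'.
have dN := cauchy_transform_derivable r0 cf' fM'.
set J := cauchy_transform e r _ in dJ; set N := cauchy_transform e r _ in dN.
pose q0 w := (I w)^-1 *: (N w - J w *: f e).
have dq0 : derivable q0 e 1.
  apply: derivable_scale; first exact: (derivableV I0 dI).
  apply: derivableB; first exact: dN.
  by apply: derivable_scale; [exact: dJ|exact: derivable_cst].
have key w : nrm (w - e) <= r / 8 -> I w != 0 -> f w - f e = (w - e) *: q0 w.
  move=> we Iw; apply: (scalerI Iw); rewrite scalerBr -I_formula //.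
  rewrite /q0 (scalerA (I w)) (mulrC (I w)) -scalerA (scalerA (I w)) divff // scale1r.
  rewrite scalerBr scalerA.
  have /(congr1 (fun x => x + cauchy_transform e r f e)) := cauchy_transform_diff r0 cf we.
  rewrite subrK -/N => ->; rewrite I_formula // -addrA; congr (_ + _).
  have := cauchy_transform_diff r0 c1 we; rewrite -/I -/J => JE.
  have -> : (w - e) * J w = I w - I e by rewrite JE.
  by rewrite scalerBl opprB.
have nI : nrm (I e) != 0 by rewrite nrm_eq0.
have [d2 d20 HI] := (continuous_nrmP _ _).1 (derivable_continuous dI) (nrm (I e))
  ltac:(by rewrite lt_def nI nrm_ge0).
have In w : nrm (w - e) < d2 -> I w != 0.
  move=> /HI H; apply/eqP => Iw; move: H.
  by rewrite -/(I w) -/(I e) Iw sub0r nrmN ltxx.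
pose q w := if w == e then q0 e else (w - e)^-1 *: (f w - f e).
exists q; last first.
  move=> w; rewrite /q; have [->|we] := eqVneq; first by rewrite !subrr scale0r.
  by rewrite scalerA divff ?subr_eq0 // scale1r.
apply: near_eq_derivable dq0; apply/nbhs_nrmP; exists (Num.min (r / 8) d2).
  by rewrite lt_min d20 divr_gt0.
move=> w; rewrite lt_min => /andP[/ltW w1 w2]; rewrite /q.
have [->//|we] := eqVneq w e.
have we0 : w - e != 0 by rewrite subr_eq0.
by rewrite (key w w1 (In w w2)) (scalerK we0).
Qed.

Definition seg a b : set C := [set z | exists2 t : R, 0 <= t <= 1 & z = a + toC t * (b - a)].

Lemma seg_left a b : seg a b a.
Proof. by exists 0; rewrite ?lexx ?ler01 // rmorph0 mul0r addr0. Qed.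

Lemma seg_right a b : seg a b b.
Proof. by exists 1; rewrite ?lexx ?ler01 // rmorph1 mul1r addrC subrK. Qed.

Lemma midconvex_seg a b : midconvex (seg a b).
Proof.
move=> _ _ [t /andP[t0 t1] ->] [s /andP[s0 s1] ->]; exists ((t + s) / 2).
  by apply/andP; split; lra.
by rewrite fmorph_div rmorphD /= rmorph_nat /mid; field.
Qed.

Lemma seg_split a b z : seg a b z -> seg a (mid a b) z \/ seg (mid a b) b z.
Proof.
move=> [t /andP[t0 t1] ->]; have [th|th] := lerP t (1 / 2).
  left; exists (2 * t); first by apply/andP; split; lra.
  by rewrite midB rmorphM /= rmorph_nat; field.
right; exists (2 * t - 1); first by apply/andP; split; lra.
by rewrite Bmid rmorphB rmorphM /= rmorph1 rmorph_nat /mid; field.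
Qed.

Lemma seg_nrm a b z : seg a b z -> nrm (z - a) <= nrm (b - a).
Proof.
move=> [t /andP[t0 t1] ->]; rewrite addrC addKr nrmM nrm_toC ger0_norm //.
by rewrite ler_piMl // nrm_ge0.
Qed.

Lemma seg_lower_bound (V : normedModType C) (f : C -> V) (K : set C) a b :
  closed K -> midconvex K -> continuous_on K f -> (forall z, K z -> f z != 0) ->
  K a -> K b -> exists2 m : R, 0 < m & forall z, seg a b z -> m <= nrm (f z).
Proof.
move=> cK mK cf f0 Ka Kb.
pose D (t : C * C) := K t.1 /\ K t.2.
pose P (t : C * C) := exists2 m : R, 0 < m & forall z, seg t.1 t.2 z -> m <= nrm (f z).
suff : P (a, b) by [].
apply: (@local_to_global R _ (fun t => t.1) (fun t => nrm (t.2 - t.1)) D P K) => //.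
- by move=> t [].
- move=> [x y] [/= Kx Ky] H; have Km := mK _ _ Kx Ky.
  have [||//|m1 m10 H1] := H (x, mid x y); rewrite /D /= ?midB ?nrm_half ?subrr ?nrm0 //.
    exact: nrm_ge0.
  have [||//|m2 m20 H2] := H (mid x y, y); rewrite /D /= ?midB ?Bmid ?nrm_half //.
    by rewrite ler_pdivrMr // ler_peMr ?nrm_ge0 // ler1n.
  exists (Num.min m1 m2); first by rewrite lt_min m10.
  by move=> z /seg_split[/H1|/H2] h; rewrite ge_min h ?orbT.
move=> z Kz; have fz : 0 < nrm (f z) / 2 by rewrite divr_gt0 // nrm_gt0 f0.
have [d d0 H] := (continuous_nrmP _ _).1 (cf z Kz) _ fz.
exists (d / 4); first by rewrite divr_gt0.
move=> [x y] [/= Kx Ky] xyd xz; exists (nrm (f z) / 2) => // v /seg_nrm vx.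
have := H v; have := nrm_tri v x z; have := nrm_ge0 (y - x) => n0 n1 /(_ _)/wrap[].
  by lra.
have := nrm_tri (f z) (f v) 0; rewrite !subr0 (nrm_distC (f z)); lra.
Qed.

(** Increments of at most [e'] times the length add up over halves, and a zero derivative makes them
    that small near each point. *)
Lemma zero_derivative_cst (V : normedModType C) (f : C -> V) (K : set C) a b :
  closed K -> midconvex K ->
  (forall z, K z -> exists q : C -> V, [/\ {for z, continuous q}, q z = 0 &
     forall w, f w - f z = (w - z) *: q w]) ->
  K a -> K b -> f a = f b.
Proof.
move=> cK mK f0 Ka Kb; apply/esym/eqP; rewrite -subr_eq0 -nrm_eq0.
rewrite eq_le nrm_ge0 andbT; apply/ler_addgt0Pr => e e0; rewrite add0r.
set s := nrm (b - a); have s0 : 0 < s + 1 by rewrite ltr_wpDl // nrm_ge0.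
have e'0 : 0 < e / (s + 1) by rewrite divr_gt0.
set e' := e / (s + 1) in e'0.
pose D (t : C * C) := K t.1 /\ K t.2.
pose P (t : C * C) := nrm (f t.2 - f t.1) <= nrm (t.2 - t.1) * e'.
have : P (a, b).
  apply: (@local_to_global R _ (fun t => t.1) (fun t => nrm (t.2 - t.1)) D P K) => //.
  - by move=> t [].
  - move=> [x y] [/= Kx Ky] H; have Km := mK _ _ Kx Ky.
    have := H (x, mid x y); rewrite /D /P /= ?midB ?nrm_half ?subrr ?nrm0 //.
    move=> /(_ (conj Kx Km) erefl (nrm_ge0 _)) H1.
    have := H (mid x y, y); rewrite /D /P /= ?midB ?Bmid ?nrm_half //.
    move=> /(_ (conj Km Ky) erefl _)/wrap[].
      by have := nrm_ge0 (y - x); lra.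
    by have := nrm_tri (f y) (f (mid x y)) (f x); lra.
  move=> z Kz; have [q [qc qz fq]] := f0 z Kz.
  have e6 : 0 < e' / 6 by rewrite divr_gt0.
  have [d d0 H] := (continuous_nrmP _ _).1 qc _ e6.
  exists (d / 4); first by rewrite divr_gt0.
  move=> [x y] [/= Kx Ky] xyd xz; rewrite /P /=.
  have n0 := nrm_ge0 (y - x).
  have F v : nrm (v - z) <= 3 * nrm (y - x) ->
      nrm (f v - f z) <= 3 * nrm (y - x) * (e' / 6).
    move=> vz; rewrite fq nrmZ ler_pM ?nrm_ge0 //; apply/ltW.
    by have := H v; rewrite qz subr0; apply; lra.
  have := F x; have := F y; have := nrm_tri y x z.
  have := nrm_tri (f y) (f z) (f x); rewrite (nrm_distC (f z)).
  by move=> t1 t2 /(_ _)/wrap[]; [lra|move=> Fy /(_ _)/wrap[]; [lra|move=> Fx; lra]].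
rewrite /P /= => /le_trans; apply; rewrite /e' mulrA ler_pdivrMr // mulrC.
by apply: ler_wpM2l; [exact: ltW|rewrite /s lerDl].
Qed.

End DividedDifference.

(** * Injective holomorphic functions have nonzero derivative *)

Section Injective.
Variable R : realType.
Local Notation C := (Cx R).
Local Notation toC := (real_complex R : R -> Cx R).
Implicit Types (a b c z w : C).

(** A maximum principle with a loose constant: Cauchy's formula at [e] gives
    [3 / 4 * nrm (F e) <= 72 * M]. *)
Lemma center_le (e : C) (r M : R) (F : C -> C) : 0 < r ->
  (forall z, cball e r z -> derivable F z 1) ->
  (forall z, seg (v0 e r) (v1 e r) z \/ seg (v1 e r) (v2 e r) z \/
     seg (v2 e r) (v0 e r) z -> nrm (F z) <= M) ->
  nrm (F e) <= 96 * M.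
Proof.
move=> r0 dF FM; have ee := center_near e r0.
have sb z : sides e r z -> cball e r z by move=> /sidesP[p [q [/side_cball]]].
have cF : continuous_on (sides e r) F by move=> z /sb /dF; exact: derivable_continuous.
have [[s00 s20] [s01 s11] [s12 s22]] := And3 (side_v0 e r0) (side_v1 e r0) (side_v2 e r0).
have := cauchy_formula r0 dF ee; rewrite /cauchy_transform => E.
have : nrm (contour e r (fun z => (z - e)^-1 *: F z)) <= 9 * r * (8 / r * M).
  have cg := kernelZ_continuous r0 ee cF.
  have mL p q a b := midconvexI (@midconvex_seg R a b) (@midconvex_side R e r p q).
  apply: (contour_le_on r0 cg (mL 1 2 (v0 e r) (v1 e r)) (mL (-2) 0 (v1 e r) (v2 e r))
    (mL 1 (-2) (v2 e r) (v0 e r))).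
  1-6: by split=> //; [exact: seg_left || exact: seg_right].
  have n0 := @nrm_ge0 R C.
  move=> z H; have [zs FMz] : sides e r z /\ nrm (F z) <= M.
    by split; [rewrite /sides /=; case: H => [[[]|[]]|[]]; tauto|
      apply: FM; case: H => [[[]|[]]|[]]; tauto].
  by rewrite nrmZ ler_pM //; exact: (nrm_kernel_le r0 zs ee).
rewrite E nrmZ; have := winding_lower_bound e r0.
set k := nrm (contour _ _ _) => k34.
have -> : 9 * r * (8 / r * M) = 72 * M by field; rewrite gt_eqF.
have := ler_wpM2r (nrm_ge0 (F e)) k34; lra.
Qed.

(* For [z1] near [e] with [phi' z1 != 0] the function [(z - z1) / (phi z - phi z1)]
   is holomorphic, so Cauchy's formula bounds its value at [e] uniformly in [z1].
   If [phi' e = 0] this value tends to infinity as [z1] tends to [e]; hence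
   [phi' = 0] near [e], and [phi] is locally constant. *)
Lemma injective_derivative_neq0 (phi q : C -> C) e (d : R) : 0 < d ->
  (forall z, nrm (z - e) < d -> derivable phi z 1) ->
  (forall z w, nrm (z - e) < d -> nrm (w - e) < d -> phi z = phi w -> z = w) ->
  {for e, continuous q} -> (forall w, phi w - phi e = (w - e) *: q w) ->
  q e != 0.
Proof.
move=> d0 dphi inj qc phiq; apply/eqP => qe.
pose r := d / 3; have r0 : 0 < r by rewrite divr_gt0.
have sb z : sides e r z -> cball e r z by move=> /sidesP[p [q' [/side_cball]]].
have bd z : cball e r z -> nrm (z - e) < d.
  by rewrite /cball /= => /le_lt_trans; apply; rewrite /r; lra.
have [[s00 s20] [s01 s11] [s12 s22]] := And3 (side_v0 e r0) (side_v1 e r0) (side_v2 e r0).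
have ee : nrm (e - e) < d by rewrite subrr nrm0.
pose psi z := phi z - phi e.
have cpsi K : (forall z, K z -> cball e r z) -> continuous_on K psi.
  move=> Kb z /Kb /bd zd; apply: continuous_at_B; last exact: continuous_at_cst.
  exact: derivable_continuous (dphi z zd).
have psi0 p q' z : `|p| + `|q'| <= 3 -> side e r p q' z -> psi z != 0.
  move=> pq zs; rewrite subr_eq0; apply/eqP => pz.
  have ze : z = e := inj _ _ (bd _ (side_cball zs)) ee pz.
  have := side_apart pq zs (center_near e r0).
  by rewrite ze subrr /linform /= !mulr0 addr0 leNgt divr_gt0.
have n12 : `|1 : R| + `|2 : R| <= 3 by rewrite !ger0_norm //; lra.
have n20 : `|-2 : R| + `|0 : R| <= 3 by rewrite normrN normr0 ger0_norm //; lra.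
have n12' : `|1 : R| + `|-2 : R| <= 3 by rewrite normrN !ger0_norm //; lra.
(* Injectivity excludes zeros of [psi] on the contour, and bisection turns this into a positive
   lower bound. *)
have [m [m0 mpsi]] : exists m : R, 0 < m /\ forall z,
    seg (v0 e r) (v1 e r) z \/ seg (v1 e r) (v2 e r) z \/ seg (v2 e r) (v0 e r) z ->
    cball e r z /\ m <= nrm (psi z).
  have H p q' a b : `|p| + `|q'| <= 3 -> side e r p q' a -> side e r p q' b ->
      exists2 m : R, 0 < m & forall z, seg a b z -> m <= nrm (psi z).
    move=> pq sa sb'.
    apply: (seg_lower_bound (@closed_side _ e r p q') (@midconvex_side _ e r p q') _ _ sa sb').
      by apply: cpsi => z; exact: side_cball.
    by move=> z; exact: psi0.
  have [m1 m10 H1] := H _ _ _ _ n12 s00 s01.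
  have [m2 m20 H2] := H _ _ _ _ n20 s11 s12.
  have [m3 m30 H3] := H _ _ _ _ n12' s22 s20.
  have segb a b z : cball e r a -> cball e r b -> seg a b z -> cball e r z.
    move=> ca cb [t /andP[t0 t1] ->]; rewrite /cball /=.
    have -> : a + toC t * (b - a) - e = toC (1 - t) * (a - e) + toC t * (b - e).
      by rewrite rmorphB rmorph1; ring.
    rewrite (le_trans (nrmD _ _)) // !nrmM !nrm_toC !ger0_norm ?subr_ge0 //.
    have := ler_wpM2l t0 cb; have t1' : 0 <= 1 - t by rewrite subr_ge0.
    by have := ler_wpM2l t1' ca; rewrite /cball /=; lra.
  exists (Num.min m1 (Num.min m2 m3)); split; first by rewrite !lt_min m10 m20.
  move=> z [|[|]] zs; rewrite !ge_min.
  - by split; [exact: (segb _ _ _ (side_cball s00) (side_cball s01))|rewrite H1].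
  - by split; [exact: (segb _ _ _ (side_cball s11) (side_cball s12))|rewrite H2 ?orbT].
  - by split; [exact: (segb _ _ _ (side_cball s22) (side_cball s20))|rewrite H3 ?orbT].
(* For [z] on the contour and [z1] near [e], [nrm (z - z1) <= 3 * r] and
   [nrm (phi z - phi z1) >= m / 2]; [B] is the quotient of these bounds. *)
pose B := 6 * r / m; have B0 : 0 < B by rewrite divr_gt0 // mulr_gt0.
have cB : 0 < (96 * B)^-1 by rewrite invr_gt0 mulr_gt0.
have [d1 d10 Hq] := (continuous_nrmP _ _).1 qc _ cB.
have m2 : 0 < m / 2 by rewrite divr_gt0.
have [d2 d20 Hphi] := (continuous_nrmP _ _).1 (derivable_continuous (dphi e ee)) _ m2.
pose s := Num.min (r / 8) (Num.min d1 d2).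
have s0 : 0 < s by rewrite !lt_min d10 d20 divr_gt0.
have flat z1 : nrm (z1 - e) < s -> exists q1 : C -> C,
    [/\ {for z1, continuous q1}, q1 z1 = 0 &
     forall w, phi w - phi z1 = (w - z1) *: q1 w].
  rewrite !lt_min => /and3P[z1r z1d1 z1d2].
  have [z1e|z1e] := eqVneq z1 e; first by rewrite z1e; exists q; split; [exact: qc|exact: qe|exact: phiq].
  have z1d : nrm (z1 - e) < d by rewrite (lt_trans z1r) // /r; lra.
  have [|z zz1|q1 dq1 phiq1] := @divided_difference_derivable R C phi z1 (d - nrm (z1 - e)).
  - by rewrite subr_gt0.
  - by apply: dphi; have := nrm_tri z z1 e; lra.
  exists q1; split; [exact: (derivable_continuous dq1)| |exact: phiq1].
  apply/eqP; apply/negPn/negP => q1z1.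
  have q1E w : w != z1 -> q1 w = (w - z1)^-1 *: (phi w - phi z1).
    by move=> wz; rewrite phiq1 scalerK // subr_eq0.
  have q10 w : nrm (w - e) < d -> q1 w != 0.
    move=> wd; have [->//|wz1] := eqVneq w z1.
    apply/eqP => q1w; move: (phiq1 w); rewrite q1w scaler0 => /eqP.
    by rewrite subr_eq0 => /eqP /(inj _ _ wd z1d) /eqP; rewrite (negPf wz1).
  have dq w : nrm (w - e) < d -> derivable q1 w 1.
    move=> wd; have [->|wz1] := eqVneq w z1; first exact: dq1.
    have : derivable (fun v => (v - z1)^-1 *: (phi v - phi z1)) w 1.
      exact: (derivable_divided wz1 (dphi w wd)).
    apply: near_eq_derivable; apply/nbhs_nrmP; exists (nrm (w - z1)).
      by rewrite nrm_gt0 subr_eq0.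
    move=> v vw; rewrite q1E //; apply: contraTneq vw => ->.
    by rewrite nrm_distC ltxx.
  have : nrm ((q1 e)^-1) <= 96 * B.
    apply: (@center_le e r B (fun z => (q1 z)^-1) r0) => [z /bd zd|z /mpsi[zb mz]].
      exact: (derivableV (q10 z zd) (dq z zd)).
    have zz1 : z != z1.
      apply: contraTneq mz => ->; rewrite -ltNge.
      by have := Hphi z1 z1d2; rewrite /psi; lra.
    rewrite q1E // invfM invrK.
    have phiz : m / 2 <= nrm (phi z - phi z1).
      have := nrm_tri (phi z) (phi z1) (phi e); have := Hphi z1 z1d2.
      by move: mz; rewrite /psi; lra.
    rewrite nrmM nrmV /B; apply: (@le_trans _ _ ((3 * r) * (m / 2)^-1)); last first.
      by rewrite invf_div mulrA le_eqVlt; apply/orP; left; apply/eqP; field; rewrite gt_eqF.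
    rewrite ler_pM ?nrm_ge0 ?invr_ge0 ?nrm_ge0 //.
      have := nrm_tri z e z1; rewrite (nrm_distC e z1); move: zb; rewrite /cball /=; lra.
    by rewrite lef_pV2 ?posrE // (lt_le_trans m2).
  (* Divided differences are symmetric. As [q e = 0], the value [q z1] is too small for the bound
     [96 * B] on the inverse of [q1 e]. *)
  have q1e : q1 e = q z1.
    rewrite q1E 1?eq_sym //; apply: (scalerI (a := z1 - e)); first by rewrite subr_eq0.
    rewrite -phiq scalerA -(opprB e z1) mulNr divff ?subr_eq0 1?eq_sym //.
    by rewrite scaleN1r opprB.
  rewrite nrmV q1e; have := Hq z1 z1d1; rewrite qe subr0 => H1.
  rewrite leNgt => /negP; apply.
  rewrite -[96 * B]invrK ltf_pV2 ?posrE // nrm_gt0 -q1e; exact: q10.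
(* By [flat], [phi] is constant on this disk; its equal values at [e] and [e + toC (s / 2)]
   contradict injectivity. *)
have cbs : closed [set z : C | nrm (z - e) <= s / 2] by exact: closed_nrm_ball.
have mbs := @midconvex_ball R e (s / 2).
have bs z : nrm (z - e) <= s / 2 -> nrm (z - e) < s.
  by move=> /le_lt_trans; apply; lra.
have es : nrm (e + toC (s / 2) - e) = s / 2.
  by rewrite addrC addKr nrm_toC ger0_norm // divr_ge0 // ltW.
have sd : s < d.
  by rewrite (@le_lt_trans _ _ (r / 8)) ?ge_min ?lexx // /r; lra.
have e1 : nrm (e - e) <= s / 2 by rewrite subrr nrm0 divr_ge0 // ltW.
have e2 : nrm (e + toC (s / 2) - e) <= s / 2 by rewrite es.
have e2d : nrm (e + toC (s / 2) - e) < d by rewrite es; lra.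
have /(inj _ _ ee e2d) E :=
  zero_derivative_cst cbs mbs (fun z zs => flat z (bs z zs)) e1 e2.
by move: es; rewrite -E subrr nrm0 => H; lra.
Qed.

End Injective.

(** * Division by a conformal map, Moebius maps and norms of the field *)

Section Field.
Variable R : realType.
Local Notation C := (Cx R).
Implicit Types (a b c z w : C).

(** Near [w], [g] and [psi] are [z - w] times divided differences [p] and [q] differentiable at [w],
    so the quotient extends by [(q w)^-1 *: p w]. Injectivity gives [q w != 0] and excludes other
    zeros of [psi]. *)
Lemma holo_factor (E : completeNormedModType C) (U : set C) (psi : C -> C)
    (g : C -> E) w : open U -> U w -> holo_on U psi -> {in U &, injective psi} ->
  psi w = 0 -> holo_on U g -> g w = 0 ->
  exists2 f : C -> E, holo_on U f & forall z, U z -> g z = psi z *: f z.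
Proof.
move=> oU Uw hpsi ipsi psiw hg gw.
have /nbhs_nrmP[d d0 dU] : nbhs w U by exact: open_nbhs_nbhs.
have dpsi z : nrm (z - w) < d -> derivable psi z 1 by move=> /dU; exact: hpsi.
have dg z : nrm (z - w) < d -> derivable g z 1 by move=> /dU; exact: hg.
have psi0 z : U z -> z != w -> psi z != 0.
  move=> Uz; apply: contraNneq => pz; apply/eqP/ipsi; rewrite ?inE //.
  by rewrite psiw.
have [q dq psiq] := @divided_difference_derivable R C psi w d d0 dpsi.
have [p dp gp] := divided_difference_derivable d0 dg.
have qw : q w != 0.
  apply: (injective_derivative_neq0 d0 dpsi _ (derivable_continuous dq) psiq).
  by move=> z v /dU Uz /dU Uv; apply: ipsi; rewrite inE.
have psiE z : psi z = (z - w) * q z by rewrite -[LHS]subr0 -psiw psiq.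
have gE z : g z = (z - w) *: p z by rewrite -gp gw subr0.
exists (fun z => if z == w then (q w)^-1 *: p w else (psi z)^-1 *: g z); last first.
  move=> z Uz; have [->|zw] := eqVneq z w; first by rewrite psiw scale0r.
  by rewrite scalerA divff ?scale1r // psi0.
move=> z Uz; have [->|zw] := eqVneq z w.
  have : derivable (fun v => (q v)^-1 *: p v) w 1.
    by apply: derivable_scale; [exact: (derivableV qw dq)|exact: dp].
  apply: near_eq_derivable; apply/nbhs_nrmP; exists d => // v vw.
  have [->//|vNw] := eqVneq v w.
  have vw0 : v - w != 0 by rewrite subr_eq0.
  by rewrite psiE gE scalerA invfM mulrAC mulVf // mul1r.
have : derivable (fun v => (psi v)^-1 *: g v) z 1.
  apply: derivable_scale; last exact: hg.
  exact: (derivableV (psi0 z Uz zw) (hpsi z Uz)).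
apply: near_eq_derivable; apply/nbhs_nrmP; exists (nrm (z - w)).
  by rewrite nrm_gt0 subr_eq0.
move=> v vz; rewrite ifN //; apply: contraTneq vz => ->.
by rewrite nrm_distC ltxx.
Qed.

Definition moebius a z : C := (z - a) / (1 - (a^* )%C * z).

Lemma nrm_conj a : nrm ((a^* )%C : C) = nrm a.
Proof.
apply/eqP; rewrite -(@eqrXn2 _ 2) ?nrm_ge0 //.
by rewrite !nrm_sq; case: a => x y /=; rewrite sqrrN.
Qed.

Lemma moebius_denom a z : nrm a < 1 -> nrm z < 1 -> 1 - (a^* )%C * z != 0.
Proof.
move=> a1 z1; rewrite subr_eq0 eq_sym; apply/eqP => E.
have : nrm ((a^* )%C * z : C) < 1.
  by rewrite nrmM nrm_conj mulr_ilt1 ?nrm_ge0.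
by rewrite E /nrm normr1 /= ltxx.
Qed.

(** Rests on [|1 - conj a * z|^2 - |z - a|^2 = (1 - |a|^2) * (1 - |z|^2)]. *)
Lemma moebius_disk a z : nrm a < 1 -> nrm z < 1 -> nrm (moebius a z) < 1.
Proof.
move=> a1 z1; have d0 := moebius_denom a1 z1.
rewrite /moebius nrmM nrmV ltr_pdivrMr ?nrm_gt0 // mul1r.
rewrite -(@ltr_pXn2r _ 2) ?nnegrE ?nrm_ge0 //.
have a2 : nrm a ^+ 2 < 1 by rewrite expr_lt1 ?nrm_ge0.
have z2 : nrm z ^+ 2 < 1 by rewrite expr_lt1 ?nrm_ge0.
have : 0 < (1 - nrm a ^+ 2) * (1 - nrm z ^+ 2) by rewrite mulr_gt0 ?subr_gt0.
rewrite !nrm_sq; case: a z {a1 z1 d0 a2 z2} => [x y] [u v] /=.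
by set P := _ * _ => HP; rewrite -subr_gt0 (_ : _ - _ = P) // /P; ring.
Qed.

Lemma moebiusK a z : nrm a < 1 -> nrm z < 1 -> moebius a (moebius (- a) z) = z.
Proof.
move=> a1 z1; have na1 : nrm (- a) < 1 by rewrite nrmN.
have := moebius_denom na1 z1; have := moebius_denom a1 (moebius_disk na1 z1).
have := moebius_denom a1 a1.
rewrite /moebius rmorphN /= mulNr !opprK; set b := (a^* )%C => h1 h2 h3.
have E : 1 - b * ((z + a) / (1 + b * z)) = (1 - b * a) / (1 + b * z) by field.
by rewrite E; field; rewrite h3 h1.
Qed.

Lemma moebius_conformal (U : set C) (phi : C -> C) a : conformal_equiv U phi ->
  nrm a < 1 -> conformal_equiv U (fun z => moebius a (phi z)).
Proof.
move=> [hphi [fphi iphi sphi]] a1; split.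
  move=> z Uz; have pz := fphi z Uz; pose b : C := (a^* )%C.
  have dn : derivable (fun v => 1 - b * phi v) z 1.
    apply: derivableB; first exact: derivable_cst.
    have := @derivable_scale R C (fun=> b) phi z.
    by apply; [exact: derivable_cst|exact: hphi].
  have dd : derivable (fun v => (1 - b * phi v)^-1) z 1.
    exact: (derivableV (moebius_denom a1 pz) dn).
  have dm : derivable (fun v => phi v - a) z 1.
    by apply: derivableB; [exact: hphi|exact: derivable_cst].
  exact: (@derivable_scale R C (fun v => phi v - a) _ z dm dd).
split.
- by move=> z Uz; apply: moebius_disk => //; exact: fphi.
- move=> z v; rewrite !inE => Uz Uv E; apply: iphi; rewrite ?inE //.
  have na1 : nrm (- a) < 1 by rewrite nrmN.
  have := congr1 (moebius (- a)) E.
  have K u : nrm u < 1 -> moebius (- a) (moebius a u) = u.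
    by move=> u1; have := moebiusK na1 u1; rewrite opprK.
  by rewrite !K //; exact: fphi.
- move=> y y1; have na1 : nrm (- a) < 1 by rewrite nrmN.
  have [z Uz zE] := sphi _ (moebius_disk na1 y1).
  by exists z => //; rewrite zE moebiusK.
Qed.

Section Norms.
Variables (E X : completeNormedModType C) (U : set C) (F : X -> C -> E).
Hypotheses (oU : open U) (HF : is_interpolation_field U F).

Lemma fieldZD w k x y : U w -> F (k *: x + y) w = k *: F x w + F y w.
Proof. by move=> Uw; case: HF => H _ _ _ _; exact: H. Qed.

Lemma fieldD w x y : U w -> F (x + y) w = F x w + F y w.
Proof. by move=> Uw; have := fieldZD 1 x y Uw; rewrite !scale1r. Qed.

Lemma field0 w : U w -> F 0 w = 0.
Proof. by move=> Uw; apply: (addIr (F 0 w)); rewrite -fieldD // !add0r. Qed.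

Lemma fieldZ w k x : U w -> F (k *: x) w = k *: F x w.
Proof. by move=> Uw; have := fieldZD k x 0 Uw; rewrite field0 // !addr0. Qed.

Lemma fieldB w x y : U w -> F (x - y) w = F x w - F y w.
Proof. by move=> Uw; rewrite -scaleN1r fieldD // fieldZ // scaleN1r. Qed.

Lemma Xw_norm_le w x v : F x w = v -> Xw_norm F w v <= nrm x.
Proof.
move=> xv; apply: ge_inf; last by exists x.
by exists 0 => _ [y _ <-]; exact: nrm_ge0.
Qed.

Lemma le_Xw_norm w x (m : R) : (forall y, F y w = F x w -> m <= nrm y) ->
  m <= Xw_norm F w (F x w).
Proof.
move=> H; apply: lb_le_inf; first by exists (nrm x), x.
by move=> _ [y /= yx <-]; exact: H.
Qed.

Lemma Xw_normD w x y : U w -> Xw_norm F w (F x w + F y w) <= nrm x + Xw_norm F w (F y w).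
Proof.
move=> Uw; rewrite -lerBlDl; apply: le_Xw_norm => z zy; rewrite lerBlDl.
by rewrite (le_trans _ (nrmD _ _)) // Xw_norm_le // fieldD // zy.
Qed.

(** If [y] agrees with [x] at [w0], then [psi w1 *: u + y] represents [F x w1], where
    [nrm u = nrm (x - y)]. Its norm is at most [nrm y * (1 + h) + h * nrm x]; taking the infimum
    over [y], itself at most [nrm x], gives the factor 2. *)
Lemma Xw_norm_near psi w0 w1 x : conformal_equiv U psi -> U w0 -> U w1 ->
  psi w0 = 0 ->
  Xw_norm F w1 (F x w1) <= Xw_norm F w0 (F x w0) + 2 * nrm (psi w1) * nrm x.
Proof.
move=> cpsi Uw0 Uw1 psi0; set h := nrm (psi w1).
have h0 : 0 <= h by exact: nrm_ge0.
have key y : F y w0 = F x w0 -> Xw_norm F w1 (F x w1) - h * nrm x <= nrm y * (1 + h).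
  move=> yx; case: HF => [_ _ hF inv _]; case: (cpsi) => hpsi [_ ipsi _].
  have [|g hg gE] := holo_factor oU Uw0 hpsi ipsi psi0 (hF (x - y)).
    by rewrite fieldB // yx subrr.
  have [fexists fnorm] := inv psi cpsi g hg.
  have xyr : represents U F (x - y) (fun z => psi z *: g z) by move=> z /gE.
  have [u ur] : exists u, represents U F u g by apply/fexists; exists (x - y).
  have un := fnorm _ _ ur xyr.
  have xE : F (psi w1 *: u + y) w1 = F x w1.
    by rewrite fieldZD // ur // -gE // fieldB // subrK.
  have := Xw_norm_le xE; have := nrmD (psi w1 *: u) y; rewrite nrmZ un -/h.
  have := ler_wpM2l h0 (nrmB x y); lra.
have h1 : 0 < 1 + h by rewrite ltr_pwDl.
have : (Xw_norm F w1 (F x w1) - h * nrm x) / (1 + h) <= Xw_norm F w0 (F x w0).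
  by apply: le_Xw_norm => y /key H; rewrite ler_pdivrMr.
rewrite ler_pdivrMr //; have := ler_wpM2l h0 (Xw_norm_le (erefl (F x w0))); lra.
Qed.

End Norms.
End Field.

(** * Banach quotients realized as ranges of linear maps *)

Section QuotientSpace.
Variable R : realType.
Local Notation C := (Cx R).
Local Notation toC := (real_complex R : R -> Cx R).

(* The quotient of a complete seminormed space [(Y, p)] by the kernel of [A],
   realized as the range of [A]. *)
Record quotient_data (Y L : lmodType C) (A : {linear Y -> L}) (p : Y -> R) : Prop :=
 QuotientData {
  qd_ge0 : forall y, 0 <= p y;
  qd_D : forall x y, p (x + y) <= p x + p y;
  qd_Z : forall (a : C) y, p (a *: y) = nrm a * p y;
  qd_separated : forall v, (forall e : R, 0 < e -> exists2 y, A y = v & p y < e) -> v = 0;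
  qd_complete : forall (u : nat -> Y) (c : R), (forall n, p (u n) <= c * 2^-1 ^+ n) ->
    exists s (c' : R), forall n, p (s - \sum_(k < n) u k) <= c' * 2^-1 ^+ n }.

Section Range.
Variables (Y L : lmodType C) (A : {linear Y -> L}).

Definition in_range : {pred L} := fun v => `[< exists y, A y = v >].

Lemma in_range_submod : submod_closed in_range.
Proof.
split; first by apply/asboolP; exists 0; rewrite linear0.
move=> a u v /asboolP[x <-] /asboolP[y <-]; apply/asboolP.
by exists (a *: x + y); rewrite linearP.
Qed.

HB.instance Definition _ := GRing.isSubmodClosed.Build C L in_range in_range_submod.

Record range_of : Type := RangeOf { range_val :> L; _ : range_val \in in_range }.
HB.instance Definition _ := [isSub for range_val].
HB.instance Definition _ := [Choice of range_of by <:].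
HB.instance Definition _ := [SubChoice_isSubLmodule of range_of by <:].

Lemma range_ofP (v : range_of) : exists y, A y = \val v.
Proof. by case: v => v /= /asboolP. Qed.

End Range.

Variables (Y L : lmodType C) (A : {linear Y -> L}) (p : Y -> R).

(** Carrying [H] in the type lets the norm and completeness instances be inferred from the type. *)
Definition quotient_space (H : quotient_data A p) : Type := range_of A.

Variable H : quotient_data A p.
Local Notation Z := (quotient_space H).

HB.instance Definition _ := GRing.Lmodule.on Z.

Definition quotient_norm (v : L) : R := inf [set p y | y in [set y | A y = v]].

Lemma quotient_norm_le v y : A y = v -> quotient_norm v <= p y.
Proof.
move=> yv; apply: ge_inf; last by exists y.
by exists 0 => _ [x _ <-]; exact: (qd_ge0 H).
Qed.

Lemma le_quotient_norm (v : Z) (m : R) : (forall y, A y = \val v -> m <= p y) ->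
  m <= quotient_norm (\val v).
Proof.
move=> Hm; have [y yv] := range_ofP v; apply: lb_le_inf; first by exists (p y), y.
by move=> _ [x /= xv <-]; exact: Hm.
Qed.

Lemma quotient_norm_lt (v : Z) (m : R) : quotient_norm (\val v) < m ->
  exists2 y, A y = \val v & p y < m.
Proof.
move=> vm; apply: contrapT => nex; move: vm; apply/negP; rewrite -leNgt.
apply: le_quotient_norm => y yv; rewrite leNgt; apply/negP => ym.
by apply: nex; exists y.
Qed.

Lemma quotient_normD (u v : Z) :
  quotient_norm (\val (u + v)) <= quotient_norm (\val u) + quotient_norm (\val v).
Proof.
rewrite -lerBlDr; apply: le_quotient_norm => x xu; rewrite lerBlDr -lerBlDl.
apply: le_quotient_norm => y yv; rewrite lerBlDl (le_trans _ (qd_D H _ _)) //.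
by apply: quotient_norm_le; rewrite linearD yv xu raddfD.
Qed.

Lemma quotient_normZ_le (a : C) (v : Z) :
  quotient_norm (\val (a *: v)) <= nrm a * quotient_norm (\val v).
Proof.
have [->|a0] := eqVneq a 0.
  have p0 : p 0 = 0 by rewrite -(scale0r (0 : Y)) (qd_Z H) nrm0 mul0r.
  rewrite nrm0 mul0r -p0; apply: quotient_norm_le.
  by rewrite linear0 scale0r raddf0.
rewrite mulrC -ler_pdivrMr ?nrm_gt0 //; apply: le_quotient_norm => y yv.
rewrite ler_pdivrMr ?nrm_gt0 // mulrC -(qd_Z H).
by apply: quotient_norm_le; rewrite !linearZ /= yv.
Qed.

Lemma quotient_normZ (a : C) (v : Z) :
  quotient_norm (\val (a *: v)) = nrm a * quotient_norm (\val v).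
Proof.
apply/eqP; rewrite eq_le quotient_normZ_le /=.
have [->|a0] := eqVneq a 0.
  rewrite nrm0 mul0r; by apply: (@le_quotient_norm (0 *: v)) => y _; exact: (qd_ge0 H).
rewrite mulrC -ler_pdivlMr ?nrm_gt0 //.
have := quotient_normZ_le a^-1 (a *: v).
by rewrite scalerA mulVf // scale1r nrmV mulrC.
Qed.

Lemma quotient_norm_eq0 (v : Z) : quotient_norm (\val v) = 0 -> v = 0.
Proof.
move=> v0; apply: val_inj; rewrite raddf0; apply: (qd_separated H) => e e0.
by apply: quotient_norm_lt; rewrite v0.
Qed.

Definition quotient_normC (v : Z) : C := toC (quotient_norm (\val v)).

Lemma quotient_normCD (u v : Z) :
  quotient_normC (u + v) <= quotient_normC u + quotient_normC v.
Proof. by rewrite /quotient_normC -rmorphD lecR quotient_normD. Qed.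

Lemma quotient_normCZ (a : C) (v : Z) :
  quotient_normC (a *: v) = `|a| * quotient_normC v.
Proof. by rewrite /quotient_normC quotient_normZ rmorphM /= normE. Qed.

Lemma quotient_normC_eq0 (v : Z) : quotient_normC v = 0 -> v = 0.
Proof. by move=> /complexI /quotient_norm_eq0. Qed.

HB.instance Definition _ := Lmodule_isNormed.Build C Z
  quotient_normCD quotient_normCZ quotient_normC_eq0.

Lemma quotient_nrmE (v : Z) : nrm v = quotient_norm (\val v).
Proof. by []. Qed.

(** Differences of a fast Cauchy sequence lift to [Y] with geometrically small [p]. The lifts are
    summed there by [qd_complete], and [A] maps the sum to the limit. *)
Lemma quotient_complete (F : set_system Z) : ProperFilter F -> cauchy F -> cvg F.
Proof.
move=> FF /(cauchy_nrmP FF) cF.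
have h0 n : 0 < (2^-1 : R) ^+ n / 4 by rewrite divr_gt0 ?exprn_gt0.
have [x xP] := choice (fun n => cF _ (h0 n)).
have xx n : nrm (x n.+1 - x n) < 2^-1 ^+ n.
  have [y [/= y1 y2]] := filter_ex (filterI (xP n) (xP n.+1)).
  apply: le_lt_trans (nrm_tri _ y _) _; rewrite (nrm_distC _ y).
  by move: y1 y2; rewrite exprS; have := h0 n; lra.
have step n : exists y, A y = \val (x n.+1 - x n) /\ p y <= 1 * 2^-1 ^+ n.
  have [y yE yp] := quotient_norm_lt (xx n).
  by exists y; split=> //; rewrite mul1r ltW.
have [u uP] := choice step.
have Asum n : A (\sum_(k < n) u k) = \val (x n) - \val (x 0%N).
  elim: n => [|n IH]; first by rewrite big_ord0 linear0 subrr.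
  by rewrite big_ord_recr /= linearD IH (uP n).1 /= addrC subrKA.
have [s [c sP]] := qd_complete H (fun n => (uP n).2).
have sx : A s \in in_range A by apply/asboolP; exists s.
pose l : Z := (RangeOf sx : range_of A) + x 0%N.
have lx n : nrm (x n - l) <= c * 2^-1 ^+ n.
  rewrite nrm_distC quotient_nrmE.
  have -> : \val (l - x n) = A (s - \sum_(k < n) u k).
    by rewrite [RHS]linearB Asum /l /= opprB addrA.
  rewrite (le_trans (quotient_norm_le (erefl _))) //; exact: sP.
apply/cvg_ex; exists l; apply/(cvg_nrmP (F := F) id) => e e0.
have [N HN] := half_pow_small (c + 1) e0.
apply: filterS (xP N) => y /= yN.
by apply: le_lt_trans (nrm_tri _ (x N) _) _; have := lx N; have := h0 N; lra.
Qed.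

HB.instance Definition _ := Uniform_isComplete.Build Z quotient_complete.
End QuotientSpace.

(** * The glued sum and the Kadets distance *)

Section Kadets.
Variable R : realType.
Local Notation C := (Cx R).
Local Notation toC := (real_complex R : R -> Cx R).

Lemma sup_ge0 (S : set R) : (forall x, S x -> 0 <= x) -> 0 <= sup S.
Proof.
move=> S0; have [hS|hS] := pselect (has_sup S); last by rewrite sup_out.
have [[x Sx] _] := hS; apply: le_trans (S0 x Sx) _.
exact: sup_upper_bound.
Qed.

Lemma inf_ge0 (S : set R) : (forall x, S x -> 0 <= x) -> 0 <= inf S.
Proof.
move=> S0; have [->|/set0P nS] := eqVneq S set0; first by rewrite inf0.
by apply: lb_le_inf.
Qed.

Lemma sup_le (S : set R) (m : R) : 0 <= m -> (forall x, S x -> x <= m) -> sup S <= m.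
Proof.
move=> m0 Sm; have [->|/set0P nS] := eqVneq S set0; first by rewrite sup0.
by apply: ge_sup.
Qed.

Lemma hausdorff_ge0 (Z : normedModType C) (A B : set Z) : 0 <= hausdorff A B.
Proof.
rewrite /hausdorff le_max; apply/orP; left; apply: sup_ge0 => _ [z _ <-].
by apply: inf_ge0 => _ [b _ <-]; exact: nrm_ge0.
Qed.

Lemma dist_set_le (Z : normedModType C) (z : Z) (B : set Z) (m : R) :
  (forall e : R, 0 < e -> exists2 b, B b & nrm (z - b) <= m + e) -> dist_set z B <= m.
Proof.
move=> H; apply/ler_addgt0Pr => e /H[b Bb zb]; apply: le_trans zb.
apply: ge_inf; last by exists b.
by exists 0 => _ [y _ <-]; exact: nrm_ge0.
Qed.

Variables (E X : completeNormedModType C) (U : set C) (F : X -> C -> E).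
Hypothesis HF : is_interpolation_field U F.
Variables (xi eta : C) (delta : R).
Hypotheses (Uxi : U xi) (Ueta : U eta) (delta_gt0 : 0 < delta).
Hypothesis near_xi : forall x,
  Xw_norm F xi (F x xi) <= Xw_norm F eta (F x eta) + delta * nrm x.
Hypothesis near_eta : forall x,
  Xw_norm F eta (F x eta) <= Xw_norm F xi (F x xi) + delta * nrm x.

Local Notation Y := (X * X * X)%type.
Local Notation L := (E * E)%type.

(** The minus sign makes the third coordinate contribute the difference between the two embedded
    values of one field element. *)
Definition glue (y : Y) : L := (F y.1.1 xi + F y.2 xi, F y.1.2 eta - F y.2 eta).

Lemma glue_linear : linear glue.
Proof.
move=> k [[a b] x] [[a' b'] x']; rewrite /glue /= !(fieldZD HF) //.
by apply: injective_projections; rewrite /= ?scalerBr ?scalerDr ?opprD addrACA.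
Qed.

HB.instance Definition _ := GRing.isLinear.Build C Y L *:%R glue glue_linear.

Definition weight (y : Y) : R := nrm y.1.1 + nrm y.1.2 + delta * nrm y.2.

Lemma weight_ge a b x :
  [/\ nrm a <= weight (a, b, x), nrm b <= weight (a, b, x) &
      nrm x <= weight (a, b, x) / delta].
Proof.
have [a0 b0 x0] := And3 (nrm_ge0 a) (nrm_ge0 b) (nrm_ge0 x).
have dx : 0 <= delta * nrm x by rewrite mulr_ge0 // ltW.
by rewrite ler_pdivlMr // mulrC /weight /=; split; lra.
Qed.

Lemma partial_sum_cvg (W : completeNormedModType C) (u : nat -> W) (c : R) :
  (forall n, nrm (u n) <= c * 2^-1 ^+ n) ->
  exists l, forall n, nrm (l - \sum_(k < n) u k) <= 2 * c * 2^-1 ^+ n.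
Proof.
move=> uc; have [n|l _ lP] := @geometric_cvg R W (fun n => \sum_(k < n) u k) c.
  by rewrite big_ord_recr /= addrAC subrr add0r.
by exists l => n; rewrite nrm_distC.
Qed.

(** Separation comes from bounded evaluations at [xi] and [eta], completeness from summing each
    coordinate in [X]; both divide by [delta] to control the third. *)
Lemma glue_data : @quotient_data R Y L glue weight.
Proof.
have d0 := ltW delta_gt0.
split.
- by move=> y; rewrite /weight !addr_ge0 ?mulr_ge0 ?nrm_ge0.
- move=> [[a b] x] [[a' b'] x']; rewrite /weight /=.
  have := nrmD a a'; have := nrmD b b'; have := ler_wpM2l d0 (nrmD x x'); lra.
- by move=> k [[a b] x]; rewrite /weight /= !nrmZ; ring.
- move=> [v1 v2] H; case: (HF) => _ _ _ _ bnd.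
  have key w (G : X -> X -> X -> E) v : U w -> (forall a b x, nrm (G a b x) <=
        nrm (F a w) + nrm (F b w) + nrm (F x w)) ->
      (forall e : R, 0 < e -> exists a b x, G a b x = v /\ weight (a, b, x) < e) -> v = 0.
    move=> /bnd[M FM] GF Gv; apply/eqP; rewrite -nrm_eq0 eq_le nrm_ge0 andbT.
    apply/ler_addgt0Pr => e e0; rewrite add0r.
    have di : 0 < delta^-1 by rewrite invr_gt0.
    set N := `|M| * (2 + delta^-1) + 1.
    have N0 : 0 < N by rewrite ltr_wpDl // mulr_ge0 // addr_ge0 // ltW.
    have [|a [b [x [<- abx]]]] := Gv (e / N); first by rewrite divr_gt0.
    rewrite ltr_pdivlMr // in abx; apply: le_trans (GF _ _ _) _.
    have [wa wb wx] := weight_ge a b x.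
    have FM' y : nrm (F y w) <= `|M| * nrm y.
      by rewrite (le_trans (FM y)) // ler_wpM2r ?nrm_ge0 // ler_norm.
    have w0 : 0 <= weight (a, b, x) := le_trans (nrm_ge0 a) wa.
    have := FM' a; have := FM' b; have := FM' x.
    have := ler_wpM2l (normr_ge0 M) wa; have := ler_wpM2l (normr_ge0 M) wb.
    have := ler_wpM2l (normr_ge0 M) wx; move: abx w0; rewrite /N.
    by set t := weight _; set m := `|M|; lra.
  congr pair.
    apply: (key xi (fun a b x => F a xi + F x xi)) => // [a b x|e /H[[[a b] x] [<- _] ab]].
      by rewrite (le_trans (nrmD _ _)) // lerD2r lerDl nrm_ge0.
    by exists a, b, x.
  apply: (key eta (fun a b x => F b eta - F x eta)) => // [a b x|e /H[[[a b] x] [_ <-] ab]].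
    by rewrite (le_trans (nrmB _ _)) // lerD2r lerDr nrm_ge0.
  by exists a, b, x.
- move=> u c uc.
  have uw n := weight_ge (u n).1.1 (u n).1.2 (u n).2.
  have [|a aP] := @partial_sum_cvg X (fun n => (u n).1.1) c.
    by move=> n; have [+ _ _] := uw n; move/le_trans; apply; have := uc n; case: (u n) => -[].
  have [|b bP] := @partial_sum_cvg X (fun n => (u n).1.2) c.
    by move=> n; have [_ + _] := uw n; move/le_trans; apply; have := uc n; case: (u n) => -[].
  have [|x xP] := @partial_sum_cvg X (fun n => (u n).2) (c / delta).
    move=> n; have [_ _ +] := uw n; move/le_trans; apply.
    rewrite mulrAC ler_pM2r ?invr_gt0 //.
    by have := uc n; case: (u n) => -[].
  exists (a, b, x), (6 * c) => n.
  have -> : (a, b, x) - \sum_(k < n) u k = (a - \sum_(k < n) (u k).1.1,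
      b - \sum_(k < n) (u k).1.2, x - \sum_(k < n) (u k).2).
    have -> : \sum_(k < n) u k = (\sum_(k < n) (u k).1.1, \sum_(k < n) (u k).1.2,
        \sum_(k < n) (u k).2).
      elim: n => [|n IH]; first by rewrite !big_ord0.
      by rewrite !big_ord_recr /= IH; case: (u n) => -[].
    by [].
  rewrite /weight /=; have := aP n; have := bP n.
  have := ler_wpM2l d0 (xP n).
  have -> : delta * (2 * (c / delta) * 2^-1 ^+ n) = 2 * c * 2^-1 ^+ n.
    by field; rewrite gt_eqF.
  lra.
Qed.

Local Notation Z := (quotient_space glue_data).

(** Isometries are functions on all of [E], hence the default 0 outside the range of [glue]. *)
Definition embed (v : L) : Z := insubd (0 : range_of glue) v.

Lemma embedE v : (exists y, glue y = v) -> \val (embed v) = v.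
Proof. by move=> Hv; rewrite insubdK //; apply/asboolP. Qed.

Lemma embed_linear (k : C) u v : (exists y, glue y = u) -> (exists y, glue y = v) ->
  embed (k *: u + v) = k *: embed u + embed v.
Proof.
move=> Hu Hv; apply: val_inj; rewrite [RHS]linearP /= !embedE //.
by case: Hu Hv => [y <-] [z <-]; exists (k *: y + z); rewrite linearP.
Qed.

Lemma glue_left x : glue (x, 0, 0) = (F x xi, 0).
Proof. by rewrite /glue /= !(field0 HF) // subr0 addr0. Qed.

Lemma glue_right x : glue (0, x, 0) = (0, F x eta).
Proof. by rewrite /glue /= !(field0 HF) // subr0 addr0. Qed.

Lemma nrm_embed v m : (exists y, glue y = v) ->
  (forall y, glue y = v -> m <= weight y) -> m <= nrm (embed v).
Proof.
by move=> Hv Hm; apply: le_quotient_norm => y; rewrite embedE //; exact: Hm.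
Qed.

Lemma nrm_embed_le v y : glue y = v -> nrm (embed v) <= weight y.
Proof.
by move=> yv; rewrite quotient_nrmE embedE; [exact: (quotient_norm_le glue_data yv)|exists y].
Qed.

(** If [glue (a, b, z) = (u, 0)] then [F b eta = F z eta], so [near_xi] bounds the norm of [F z xi]
    by [nrm b + delta * nrm z]: using [b] and [z] cannot lower the norm of [u]. *)
Lemma lin_isometry_left :
  lin_isometry (Xw F xi) (Xw_norm F xi) (fun u => embed (u, 0)).
Proof.
split=> [k _ _ [x <-] [y <-]|_ [x <-]].
  have -> : (k *: F x xi + F y xi, 0) = k *: (F x xi, 0) + (F y xi, 0) :> L.
    by apply: injective_projections; rewrite /= ?scaler0 ?addr0.
  by rewrite embed_linear //; [exists (x, 0, 0)|exists (y, 0, 0)]; exact: glue_left.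
apply/eqP; rewrite eq_le; apply/andP; split.
  apply: le_Xw_norm => y yx; apply: le_trans (nrm_embed_le (y := (y, 0, 0)) _) _.
    by rewrite glue_left yx.
  by rewrite /weight /= !nrm0 mulr0 !addr0.
apply: nrm_embed; first by exists (x, 0, 0); exact: glue_left.
move=> [[a b] z] [/= <- bz].
apply: le_trans (Xw_normD HF _ _ Uxi) _; rewrite /weight /= -addrA lerD2l.
apply: le_trans (near_xi z) _; rewrite lerD2r; apply: (@Xw_norm_le R E X F).
by apply/eqP; rewrite -subr_eq0 bz.
Qed.

Lemma lin_isometry_right :
  lin_isometry (Xw F eta) (Xw_norm F eta) (fun v => embed (0, v)).
Proof.
split=> [k _ _ [x <-] [y <-]|_ [x <-]].
  have -> : (0, k *: F x eta + F y eta) = k *: (0, F x eta) + (0, F y eta) :> L.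
    by apply: injective_projections; rewrite /= ?scaler0 ?addr0.
  by rewrite embed_linear //; [exists (0, x, 0)|exists (0, y, 0)]; exact: glue_right.
apply/eqP; rewrite eq_le; apply/andP; split.
  apply: le_Xw_norm => y yx; apply: le_trans (nrm_embed_le (y := (0, y, 0)) _) _.
    by rewrite glue_right yx.
  by rewrite /weight /= !nrm0 mulr0 addr0 add0r.
apply: nrm_embed; first by exists (0, x, 0); exact: glue_right.
move=> [[a b] z] [/= az <-].
have zE : F (- z) eta = - F z eta by rewrite -scaleN1r (fieldZ HF) // scaleN1r.
have zE' : F (- z) xi = - F z xi by rewrite -scaleN1r (fieldZ HF) // scaleN1r.
rewrite -zE; apply: le_trans (Xw_normD HF _ _ Ueta) _.
rewrite /weight /= (addrC (nrm a)) -addrA lerD2l.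
apply: le_trans (near_eta (- z)) _; rewrite nrmN lerD2r; apply: (@Xw_norm_le R E X F).
by rewrite zE'; apply/eqP; rewrite -subr_eq0 opprK az.
Qed.

(** The infimum need not be attained: a vector of the unit ball has representatives of norm below
    [1 + e], and dividing one by [1 + e] moves it by at most [e]. *)
Lemma Xw_ball_rescale w v (e : R) : U w -> ball1 (Xw F w) (Xw_norm F w) v -> 0 < e ->
  exists x y, [/\ F x w = v, nrm y <= 1 & nrm (x - y) <= e].
Proof.
move=> Uw [[x0 xv] v1] e0.
have [x xE xe] : exists2 x, F x w = v & nrm x < 1 + e.
  apply: contrapT => nex.
  have : 1 + e <= Xw_norm F w (F x0 w).
    apply: le_Xw_norm => y yx; rewrite leNgt; apply/negP => ye.
    by apply: nex; exists y; rewrite // yx.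
  by rewrite xv; lra.
have e1 : 0 < 1 + e by lra.
exists x, (toC (1 + e)^-1 *: x); split=> //.
  by rewrite nrmZ nrm_toC ger0_norm ?invr_ge0 ?(ltW e1) // mulrC ler_pdivrMr // mul1r ltW.
have -> : x - toC (1 + e)^-1 *: x = toC (1 - (1 + e)^-1) *: x.
  by rewrite rmorphB rmorph1 scalerBl scale1r.
have k0 : 1 - (1 + e)^-1 = e / (1 + e) by field; rewrite gt_eqF.
rewrite nrmZ nrm_toC k0 ger0_norm ?divr_ge0 ?(ltW e0) ?(ltW e1) //.
by rewrite mulrAC ler_pdivrMr // ler_pM2l // ltW.
Qed.

Lemma kadets_le_of_near :
  kadets (Xw F xi) (Xw_norm F xi) (Xw F eta) (Xw_norm F eta) <= delta.
Proof.
have d0 := ltW delta_gt0.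
pose T (u : E) : Z := embed (u, 0); pose V (v : E) : Z := embed (0, v).
pose A := T @` ball1 (Xw F xi) (Xw_norm F xi).
pose B := V @` ball1 (Xw F eta) (Xw_norm F eta).
apply: (@le_trans _ _ (hausdorff A B)).
  apply: ge_inf.
    by exists 0 => _ [Z' [T' [V' [_ _ ->]]]]; exact: hausdorff_ge0.
  exists Z, T, V; split=> //; [exact: lin_isometry_left|exact: lin_isometry_right].
have TV (u v : E) y : (exists x, F x xi = u) -> (exists x, F x eta = v) ->
    glue y = (u, - v) -> nrm (T u - V v) <= weight y.
  move=> [x xu] [x' xv] yE.
  have Tu : exists y, glue y = (u, 0) by exists (x, 0, 0); rewrite glue_left xu.
  have Vv : exists y, glue y = (0, v) by exists (0, x', 0); rewrite glue_right xv.
  have -> : T u - V v = embed (u, - v).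
    rewrite addrC -scaleN1r -embed_linear //; congr embed.
    by rewrite scaleN1r; congr pair; rewrite /= ?oppr0 ?add0r ?addr0.
  exact: nrm_embed_le.
rewrite /hausdorff ge_max; apply/andP; split; apply: sup_le => // _ [_ [w wb <-] <-].
- apply: dist_set_le => e e0; have [x [y [xw y1 xy]]] := Xw_ball_rescale Uxi wb e0.
  exists (V (F y eta)).
    by exists (F y eta) => //; split; [exists y|exact: le_trans (Xw_norm_le erefl) y1].
  (* Replacing [x] by [y] costs at most [e]; passing from [xi] to [eta] along [y] costs
     [delta * nrm y <= delta]. *)
  apply: le_trans (TV _ _ (x - y, 0, y) _ _ _) _.
  + by exists x.
  + by exists y.
  + by rewrite /glue /= (fieldB HF) // subrK (field0 HF) // sub0r xw.
  + rewrite /weight /= nrm0 addr0 addrC lerD //.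
    by rewrite ler_piMr.
- apply: dist_set_le => e e0; have [x [y [xw y1 xy]]] := Xw_ball_rescale Ueta wb e0.
  exists (T (F y xi)).
    by exists (F y xi) => //; split; [exists y|exact: le_trans (Xw_norm_le erefl) y1].
  rewrite nrm_distC.
  apply: le_trans (TV _ _ (0, y - x, y) _ _ _) _.
  + by exists y.
  + by exists x.
  + by rewrite /glue /= (field0 HF) // add0r (fieldB HF) // addrAC subrr sub0r xw.
  + rewrite /weight /= nrm0 add0r addrC (nrm_distC y) lerD //.
    by rewrite ler_piMr.
Qed.

End Kadets.

Unset Implicit Arguments.

Theorem theorem4p5 (R : realType) (E : completeNormedModType (Cx R))
  (U : set (Cx R)) (X : completeNormedModType (Cx R)) (F : X -> Cx R -> E) :
  open U ->
  (exists phi : Cx R -> Cx R, conformal_equiv U phi) ->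
  is_interpolation_field U F ->
  forall (xi eta : Cx R) (phi : Cx R -> Cx R),
    U xi -> U eta -> conformal_equiv U phi -> phi xi = 0 ->
    kadets (Xw F xi) (Xw_norm F xi) (Xw F eta) (Xw_norm F eta)
      <= 2 * nrm (phi eta).
Proof.
move=> oU _ HF xi eta phi Uxi Ueta cphi phixi.
set a := phi eta; have a1 : nrm a < 1 by case: cphi => _ [fphi _ _]; exact: fphi.
have cpsi := moebius_conformal cphi a1.
have psieta : moebius a (phi eta) = 0 by rewrite /moebius subrr mul0r.
have psixi : nrm (moebius a (phi xi)) = nrm a.
  by rewrite /moebius phixi sub0r mulr0 subr0 divr1 nrmN.
apply/ler_addgt0Pr => e e0.
have d0 : 0 < 2 * nrm a + e by rewrite ltr_wpDl // mulr_ge0 ?nrm_ge0.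
have widen x : 2 * nrm a * nrm x <= (2 * nrm a + e) * nrm x.
  by rewrite ler_wpM2r ?nrm_ge0 // lerDl ltW.
(* Each estimate takes a conformal map vanishing at its base point: the Moebius composite at [eta],
   [phi] itself at [xi]. *)
apply: (kadets_le_of_near HF Uxi Ueta d0) => x.
- apply: le_trans (Xw_norm_near oU HF x cpsi Ueta Uxi psieta) _.
  by rewrite lerD2l psixi.
- apply: le_trans (Xw_norm_near oU HF x cphi Uxi Ueta phixi) _.
  by rewrite lerD2l.
Qed.
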